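(* Let $K$ be a field and $E$ an arbitrary directed graph. The following are equivalent: (i) $L_K(E)$ is decomposable. (ii) There exist nonempty clopen invariant subsets $U$ and $V$ of $G_E^{(0)}$ such that $A_K(G_E)=I(U)\oplus I(V)$. (iii) There exists a nonempty, proper, hereditary and saturated subset $H$ of $E^0$ such that the following conditions are satisfied: (a) if $x\in E^\infty$ is such that $x^0\subseteq E^0\setminus H$, then there exists $N\in\mathbb N$ such that $\mathrm{Path}(r(x_N),H)=\emptyset$; (b) if $v\in E^0$ is such that $|\{e\in E^1: s(e)=v\text{ and }\mathrm{Path}(r(e),H)\ne\emptyset\}|=\infty$, then $v\in H\cup B_H$. (iv) There exists a nonempty clopen invariant subset $U\subsetneq G_E^{(0)}$.
   Context: Graphs. A directed graph $E=(E^0,E^1,r,s)$ consists of disjoint sets $E^0$ (vertices), $E^1$ (edges) of arbitrary cardinality and maps $r,s:E^1\to E^0$ (range, source). A vertex $v$ is a sink if $s^{-1}(v)=\emptyset$, an infinite emitter if $s^{-1}(v)$ is infinite, and regular otherwise; $\mathrm{Inf}(E)$ and $\mathrm{Reg}(E)$ denote the sets of infinite emitters and of regular vertices. A finite path is either a vertex $v$ (length $0$, $s(v)=r(v)=v$) or a sequence $\mu=\mu_1\cdots\mu_n$ of edges with $r(\mu_i)=s(\mu_{i+1})$, with $s(\mu)=s(\mu_1)$, $r(\mu)=r(\mu_n)$, $|\mu|=n$. $\mathrm{Path}(E)$ is the set of finite paths and $E^\infty$ the set of infinite paths $x=x_1x_2\cdots$ ($r(x_i)=s(x_{i+1})$ for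 all $i$), with $s(x)=s(x_1)$; $x^0$ is the set of vertices of $x$, i.e. $s(x)$ and all $r(x_i)$. For $v\in E^0$ and $Y\subseteq E^0$, $\mathrm{Path}(v,Y)$ is the set of finite paths $\alpha$ (including length $0$) with $s(\alpha)=v$, $r(\alpha)\in Y$. A set $H\subseteq E^0$ is hereditary if, whenever there is a path from $v\in H$ to $w$, then $w\in H$; a hereditary set $H$ is saturated if every regular vertex $v$ with $r(s^{-1}(v))\subseteq H$ lies in $H$. For $H$ hereditary, the set of breaking vertices is $B_H=\{v\in E^0\setminus H : v\in\mathrm{Inf}(E),\ 0<|s^{-1}(v)\cap r^{-1}(E^0\setminus H)|<\infty\}$. Leavitt path algebra. $L_K(E)$ is the associative $K$-algebra generated by $E^0\cup E^1\cup\{e^*:e\in E^1\}$ subject to: $vw=\delta_{v,w}v$ for $v,w\in E^0$; $s(e)e=er(e)=e$ and $r(e)e^*=e^*s(e)=e^*$ for $e\in E^1$; $e^*e'=\delta_{e,e'}r(e)$ for $e,e'\in E^1$; $v=\sum_{s(e)=v}ee^*$ for $v\in\mathrm{Reg}(E)$. $L_K(E)$ is decomposable if there are two nonzero (two-sided) ideals $I,J$ with $L_K(E)=I\oplus J$. The groupoid. $X=E^\infty\cup\{\mu\in\mathrm{Path}(E): r(\mu)\text{ is a sink or an infinite emitter}\}$ and $G_E=\{(\alpha x,|\alpha|-|\beta|,\beta x):\alpha,\beta\in\mathrm{Path}(E),\ x\in X,\ r(\alpha)=r(\beta)=s(x)\}$, with $(x,k,y)(y,l,z)=(x,k+l,z)$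 and $(x,k,y)^{-1}=(y,-k,x)$. The unit space $G_E^{(0)}=\{(x,0,x):x\in X\}$ is identified with $X$; the groupoid range and source of $\gamma=(x,k,y)$ are $r(\gamma)=\gamma\gamma^{-1}=x$, $s(\gamma)=\gamma^{-1}\gamma=y$. For $\mu\in\mathrm{Path}(E)$ put $Z(\mu)=\{\mu x: x\in X,\ s(x)=r(\mu)\}$, and for finite $F\subseteq s^{-1}(r(\mu))$ put $Z(\mu\setminus F)=Z(\mu)\setminus\bigcup_{e\in F}Z(\mu e)$; these sets form a basis of compact open sets for a Hausdorff topology on $G_E^{(0)}$. For $\mu,\nu\in\mathrm{Path}(E)$ with $r(\mu)=r(\nu)$ put $Z(\mu,\nu)=\{(\mu x,|\mu|-|\nu|,\nu x):x\in X,\ s(x)=r(\mu)\}$, and for a finite set $F$ of finite paths with source $r(\mu)$ put $Z((\mu,\nu)\setminus F)=Z(\mu,\nu)\setminus\bigcup_{\alpha\in F}Z(\mu\alpha,\nu\alpha)$; these sets form a basis of compact open bisections making $G_E$ a Hausdorff ample groupoid. (An open set $B$ is an open bisection if $r|_B$ and $s|_B$ are homeomorphisms onto open subsets of the unit space; a topological groupoid is ample if it has a basis of compact open bisections.) A subset $U\subseteq G_E^{(0)}$ is invariant if $x\in U$ and $(x,k,y)\in G_E$ imply $y\in U$. Steinberg algebra. $A_K(G_E)=\mathrm{span}_K\{1_B: B\subseteq G_E\text{ a compact open bisection}\}$, a space of functions $G_E\to K$, with pointwise addition and scalar multiplication and convolution product $(fg)(\gamma)=\sum_{\alpha\beta=\gamma}f(\alpha)g(\beta)$.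 For $U\subseteq G_E^{(0)}$ open and invariant, $I(U)=\{f\in A_K(G_E): s(\mathrm{supp} f)\subseteq U\}$, which is an ideal of $A_K(G_E)$. *)

(* Defs.v *)
From HB Require Import structures.
From mathcomp Require Import all_boot all_order all_algebra generic_quotient.
From mathcomp Require Import all_classical topology numfun zify.

Set Implicit Arguments.
Unset Strict Implicit.
Unset Printing Implicit Defensive.

Import GRing.Theory.
Local Open Scope classical_set_scope.
Local Open Scope ring_scope.
Local Open Scope quotient_scope.

HB.mixin Record Lmodule_isAssocAlgebra (K : fieldType) V
    & GRing.Lmodule K V := {
  amul : V -> V -> V;
  amulA : associative amul;
  amulDl : left_distributive amul +%R;
  amulDr : right_distributive amul +%R;
  scale_amull : forall (a : K) x y, a *: amul x y = amul (a *: x) y;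
  scale_amulr : forall (a : K) x y, a *: amul x y = amul x (a *: y)
}.

#[short(type="assocAlgType")]
HB.structure Definition AssocAlgebra (K : fieldType) :=
  {V of Lmodule_isAssocAlgebra K V & GRing.Lmodule K V}.

(** Two-sided ideals in the sense of [K]-algebras. *)
Definition ideal (K : fieldType) (A : assocAlgType K) (I : set A) : Prop :=
  [/\ I 0,
      forall x y, I x -> I y -> I (x + y),
      forall (a : K) x, I x -> I (a *: x) &
      forall a x, I x -> I (amul a x) /\ I (amul x a)].

(** [A] is the internal direct sum of [I] and [J], for [I] and [J] subgroups
    of [V]. *)
Definition direct_sum (V : zmodType) (A I J : set V) : Prop :=
  A = [set x + y | x in I & y in J] /\ I `&` J = [set 0].

Definition decomposable (K : fieldType) (A : assocAlgType K) : Prop :=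
  exists I J : set A,
    [/\ ideal I, ideal J, I <> [set 0], J <> [set 0] & direct_sum setT I J].

Definition linear_span (K : fieldType) (V : lmodType K) (S : set V) : set V :=
  [set f | exists n (c : 'I_n -> K) (b : 'I_n -> V),
     (forall i, S (b i)) /\ f = \sum_(i < n) c i *: b i].

Inductive aterm (K X : Type) : Type :=
| AGen of X
| AZero
| AAdd of aterm K X & aterm K X
| AScale of K & aterm K X
| AMul of aterm K X & aterm K X.
Arguments AGen {K X}.
Arguments AZero {K X}.

HB.instance Definition _ (K X : Type) := gen_eqMixin (aterm K X).
HB.instance Definition _ (K X : Type) := gen_choiceMixin (aterm K X).

(** The least congruence containing [R] whose quotient is a [K]-algebra. *)
Inductive acong (K : fieldType) (X : Type) (R : aterm K X -> aterm K X -> Prop)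
  : aterm K X -> aterm K X -> Prop :=
| ac_rel x y : R x y -> acong R x y
| ac_refl x : acong R x x
| ac_sym x y : acong R x y -> acong R y x
| ac_trans x y z : acong R x y -> acong R y z -> acong R x z
| ac_add x x' y y' :
    acong R x x' -> acong R y y' -> acong R (AAdd x y) (AAdd x' y')
| ac_scale a x x' : acong R x x' -> acong R (AScale a x) (AScale a x')
| ac_mul x x' y y' :
    acong R x x' -> acong R y y' -> acong R (AMul x y) (AMul x' y')
| ac_addA x y z : acong R (AAdd x (AAdd y z)) (AAdd (AAdd x y) z)
| ac_addC x y : acong R (AAdd x y) (AAdd y x)
| ac_add0 x : acong R (AAdd AZero x) x
| ac_addN x : acong R (AAdd (AScale (-1) x) x) AZero
| ac_scaleA a b x : acong R (AScale a (AScale b x)) (AScale (a * b) x)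
| ac_scale1 x : acong R (AScale 1 x) x
| ac_scaleDr a x y :
    acong R (AScale a (AAdd x y)) (AAdd (AScale a x) (AScale a y))
| ac_scaleDl a b x :
    acong R (AScale (a + b) x) (AAdd (AScale a x) (AScale b x))
| ac_mulA x y z : acong R (AMul x (AMul y z)) (AMul (AMul x y) z)
| ac_mulDl x y z :
    acong R (AMul (AAdd x y) z) (AAdd (AMul x z) (AMul y z))
| ac_mulDr x y z :
    acong R (AMul x (AAdd y z)) (AAdd (AMul x y) (AMul x z))
| ac_scalel a x y : acong R (AScale a (AMul x y)) (AMul (AScale a x) y)
| ac_scaler a x y : acong R (AScale a (AMul x y)) (AMul x (AScale a y)).

Section PresentedAlgebra.
Variables (K : fieldType) (X : Type) (R : aterm K X -> aterm K X -> Prop).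

Definition acongb : rel (aterm K X) := fun x y => `[< acong R x y >].

Lemma acongb_refl : reflexive acongb.
Proof. by move=> x; apply/asboolP; apply: ac_refl. Qed.

Lemma acongb_sym : symmetric acongb.
Proof. by move=> x y; apply/asboolP/asboolP; apply: ac_sym. Qed.

Lemma acongb_trans : transitive acongb.
Proof.
by move=> y x z /asboolP xy /asboolP yz; apply/asboolP; apply: ac_trans yz.
Qed.

Canonical acong_equiv :=
  EquivRel acongb acongb_refl acongb_sym acongb_trans.

Definition palg := {eq_quot acong_equiv}.
HB.instance Definition _ := EqQuotient.on palg.
HB.instance Definition _ := Choice.on palg.

Definition pclass (x : aterm K X) : palg := \pi_palg x.

Lemma pclassP x y : pclass x = pclass y <-> acong R x y.
Proof. by split=> [/eqmodP/asboolP|h] //; apply/eqmodP/asboolP. Qed.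

Lemma pclass_repr (u : palg) : pclass (repr u) = u.
Proof. exact: reprK. Qed.

Definition padd (u v : palg) : palg := pclass (AAdd (repr u) (repr v)).
Definition pscale (a : K) (u : palg) : palg := pclass (AScale a (repr u)).
Definition pmul (u v : palg) : palg := pclass (AMul (repr u) (repr v)).

Lemma pclass_repr_cong x : acong R (repr (pclass x)) x.
Proof. by apply/pclassP; rewrite pclass_repr. Qed.

Lemma pclassD x y : padd (pclass x) (pclass y) = pclass (AAdd x y).
Proof. by apply/pclassP; apply: ac_add; apply: pclass_repr_cong. Qed.

Lemma pclassZ a x : pscale a (pclass x) = pclass (AScale a x).
Proof. by apply/pclassP; apply: ac_scale; apply: pclass_repr_cong. Qed.

Lemma pclassM x y : pmul (pclass x) (pclass y) = pclass (AMul x y).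
Proof. by apply/pclassP; apply: ac_mul; apply: pclass_repr_cong. Qed.

Lemma pclassW (P : palg -> Prop) : (forall x, P (pclass x)) -> forall u, P u.
Proof. by move=> h u; rewrite -(pclass_repr u). Qed.

Let paddA : associative padd.
Proof.
move=> u v w; elim/pclassW: u => x; elim/pclassW: v => y; elim/pclassW: w => z.
by rewrite !pclassD; apply/pclassP; apply: ac_addA.
Qed.
Let paddC : commutative padd.
Proof.
move=> u v; elim/pclassW: u => x; elim/pclassW: v => y.
by rewrite !pclassD; apply/pclassP; apply: ac_addC.
Qed.
Let padd0 : left_id (pclass AZero) padd.
Proof.
by move=> u; elim/pclassW: u => x; rewrite pclassD; apply/pclassP; apply: ac_add0.
Qed.
Let paddN : left_inverse (pclass AZero) (pscale (-1)) padd.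
Proof.
move=> u; elim/pclassW: u => x.
by rewrite pclassZ pclassD; apply/pclassP; apply: ac_addN.
Qed.

HB.instance Definition _ := GRing.isZmodule.Build palg paddA paddC padd0 paddN.

Let pscaleA a b u : pscale a (pscale b u) = pscale (a * b) u.
Proof.
elim/pclassW: u => x.
by rewrite !pclassZ; apply/pclassP; apply: ac_scaleA.
Qed.
Let pscale1 : left_id 1 pscale.
Proof.
by move=> u; elim/pclassW: u => x; rewrite pclassZ; apply/pclassP; apply: ac_scale1.
Qed.
Let pscaleDr : right_distributive pscale +%R.
Proof.
move=> a u v; elim/pclassW: u => x; elim/pclassW: v => y.
rewrite /GRing.add /= !(pclassZ, pclassD).
by apply/pclassP; apply: ac_scaleDr.
Qed.
Let pscaleDl u : {morph pscale^~ u : a b / a + b}.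
Proof.
move=> a b; elim/pclassW: u => x.
rewrite [RHS]/GRing.add /= !(pclassZ, pclassD).
by apply/pclassP; apply: ac_scaleDl.
Qed.

HB.instance Definition _ := GRing.Zmodule_isLmodule.Build K palg
  pscaleA pscale1 pscaleDr pscaleDl.

Let pmulA : associative pmul.
Proof.
move=> u v w; elim/pclassW: u => x; elim/pclassW: v => y; elim/pclassW: w => z.
by rewrite !pclassM; apply/pclassP; apply: ac_mulA.
Qed.
Let pmulDl : left_distributive pmul +%R.
Proof.
move=> u v w; elim/pclassW: u => x; elim/pclassW: v => y; elim/pclassW: w => z.
rewrite /GRing.add /= !(pclassM, pclassD).
by apply/pclassP; apply: ac_mulDl.
Qed.
Let pmulDr : right_distributive pmul +%R.
Proof.
move=> u v w; elim/pclassW: u => x; elim/pclassW: v => y; elim/pclassW: w => z.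
rewrite /GRing.add /= !(pclassM, pclassD).
by apply/pclassP; apply: ac_mulDr.
Qed.
Let pscalel (a : K) (u v : palg) : a *: pmul u v = pmul (a *: u) v.
Proof.
elim/pclassW: u => x; elim/pclassW: v => y.
rewrite /GRing.scale /= !(pclassM, pclassZ).
by apply/pclassP; apply: ac_scalel.
Qed.
Let pscaler (a : K) (u v : palg) : a *: pmul u v = pmul u (a *: v).
Proof.
elim/pclassW: u => x; elim/pclassW: v => y.
rewrite /GRing.scale /= !(pclassM, pclassZ).
by apply/pclassP; apply: ac_scaler.
Qed.

HB.instance Definition _ := Lmodule_isAssocAlgebra.Build K palg
  pmulA pmulDl pmulDr pscalel pscaler.

End PresentedAlgebra.

Record graph : Type := Graph {
  vert : Type;
  edge : Type;
  src : edge -> vert;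
  rng : edge -> vert
}.
Arguments src {g}.
Arguments rng {g}.

Section GraphBasics.
Variable E : graph.
Implicit Types (v : vert E) (H Y : set (vert E)).

Definition sink v : Prop := src @^-1` [set v] = set0.
Definition inf_emitter v : Prop := infinite_set (src @^-1` [set v]).
Definition regular v : Prop := ~ sink v /\ ~ inf_emitter v.

Fixpoint walk v (s : seq (edge E)) : Prop :=
  if s is e :: s' then src e = v /\ walk (rng e) s' else True.

(** Recording the source separately makes the path of length 0 at [v] the walk
    from [v] without edges. *)
Record fpath : Type := FPath {
  fsrc : vert E;
  fedges : seq (edge E);
  fwalk : walk fsrc fedges
}.

Definition frng (p : fpath) : vert E := last (fsrc p) (map rng (fedges p)).
Definition flen (p : fpath) : nat := size (fedges p).

(** Edges are numbered from 0, so [x 0] is the first edge. *)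
Record ipath : Type := IPath {
  iedge :> nat -> edge E;
  iwalk : forall i, rng (iedge i) = src (iedge i.+1)
}.

Definition isrc (x : ipath) : vert E := src (x 0%N).
Definition ivertices (x : ipath) : set (vert E) :=
  isrc x |` range (fun i => rng (x i)).

Definition paths v Y : set fpath := [set p | fsrc p = v /\ Y (frng p)].

Definition hereditary H : Prop := forall p : fpath, H (fsrc p) -> H (frng p).
Definition saturated H : Prop :=
  forall v, regular v -> rng @` (src @^-1` [set v]) `<=` H -> H v.
Definition breaking H : set (vert E) :=
  [set v | [/\ ~ H v, inf_emitter v,
               src @^-1` [set v] `&` rng @^-1` (~` H) !=set0 &
               finite_set (src @^-1` [set v] `&` rng @^-1` (~` H))]].

Lemma walk_cat v s t :
  walk v (s ++ t) <-> walk v s /\ walk (last v (map rng s)) t.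
Proof.
elim: s v => [|e s IH] v /=; first by split=> [|[]].
by rewrite IH; split=> [[? []]|[[]]].
Qed.

Lemma fcat_walk (a b : fpath) (h : frng a = fsrc b) :
  walk (fsrc a) (fedges a ++ fedges b).
Proof.
apply/walk_cat; split; first exact: fwalk.
by rewrite -/(frng a) h; apply: fwalk.
Qed.

Definition fcat (a b : fpath) (h : frng a = fsrc b) : fpath :=
  FPath (fcat_walk h).

Definition fedge (e : edge E) : fpath := @FPath (src e) [:: e] (conj erefl I).

Lemma frng_fcat (a b : fpath) (h : frng a = fsrc b) : frng (fcat h) = frng b.
Proof. by rewrite /frng /= map_cat last_cat -/(frng a) h. Qed.

Lemma icat_walk (a : fpath) (x : ipath) (h : frng a = isrc x)
  (f := fun n => nth (x (n - flen a)%N) (fedges a) n) :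
  forall i, rng (f i) = src (f i.+1).
Proof.
move=> i; rewrite /f /flen; case: a h {f} => v s w.
rewrite /frng /isrc /=; elim: s v w i => [|e s IH] v /= w i h.
  by rewrite !nth_nil !subn0; apply: iwalk.
case: i => [|i] /=; last by rewrite !subSS; apply: (IH (rng e)) => //; case: w.
by rewrite subSS sub0n; case: s w h {IH} => [|e' s] /= [_ w] h //; case: w.
Qed.

Definition icat (a : fpath) (x : ipath) (h : frng a = isrc x) : ipath :=
  IPath (icat_walk h).

Inductive bpath : Type :=
| BFin (p : fpath) of sink (frng p) \/ inf_emitter (frng p)
| BInf of ipath.

Definition bsrc (x : bpath) : vert E :=
  match x with BFin p _ => fsrc p | BInf y => isrc y end.

Lemma fcat_singular (a b : fpath) (h : frng a = fsrc b) :
  sink (frng b) \/ inf_emitter (frng b) ->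
  sink (frng (fcat h)) \/ inf_emitter (frng (fcat h)).
Proof. by rewrite frng_fcat. Qed.

Definition bcat (a : fpath) (x : bpath) : frng a = bsrc x -> bpath :=
  match x with
  | BFin p hp => fun h => BFin (fcat_singular h hp)
  | BInf y => fun h => BInf (icat h)
  end.

(** [cyl a] is $Z(a)$. *)
Definition cyl (a : fpath) : set bpath :=
  [set z | exists x (h : frng a = bsrc x), z = bcat h].

Definition cyl_basis : set (set bpath) :=
  [set B | exists (a : fpath) (F : set (edge E)),
     [/\ finite_set F, F `<=` src @^-1` [set frng a] &
         B = cyl a `\` \bigcup_(e in F)
               [set z | exists h : frng a = fsrc (fedge e), cyl (fcat h) z]]].

Lemma fpath_eq (a b : fpath) : fsrc a = fsrc b -> fedges a = fedges b -> a = b.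
Proof.
case: a => v s w; case: b => v' s' w' /= ev es; subst v' s'.
by rewrite (Prop_irrelevance w w').
Qed.

Lemma ipath_eq (x y : ipath) : iedge x =1 iedge y -> x = y.
Proof.
case: x => f hf; case: y => g hg /= /funext e; subst g.
by rewrite (Prop_irrelevance hf hg).
Qed.

Lemma BFin_eq (p q : fpath) hp hq : p = q -> @BFin p hp = @BFin q hq.
Proof. by move=> e; subst q; rewrite (Prop_irrelevance hp hq). Qed.

Lemma bsrc_bcat (a : fpath) (x : bpath) (h : frng a = bsrc x) :
  bsrc (bcat h) = fsrc a.
Proof.
case: x h => [p hp|y] h //=.
case: a h => v [|e s] w h; last by have [] := w.
by rewrite -[RHS]/(frng (FPath w)) h.
Qed.

Definition bnth (x : bpath) (n : nat) : option (edge E) :=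
  match x with BFin p _ => onth (fedges p) n | BInf y => Some (y n) end.

Lemma bpath_eq (x y : bpath) : bsrc x = bsrc y -> bnth x =1 bnth y -> x = y.
Proof.
case: x => [p hp|x]; case: y => [q hq|y] /= es en.
- apply: BFin_eq; apply: fpath_eq => //.
  have {en}: onth (fedges p) =1 onth (fedges q) := en.
  move: (fedges p) (fedges q).
  elim=> [|e s IH] [|e' s'] //= en; [by have /= := en 0%N|by have /= := en 0%N|].
  have /= [->] := en 0%N; congr (_ :: _); apply: IH => n; exact: (en n.+1).
- have : onth (fedges p) (size (fedges p)) = Some _ := en _.
  by rewrite onth_default.
- have : Some _ = onth (fedges q) (size (fedges q)) := en _.
  by rewrite onth_default.
- by congr BInf; apply: ipath_eq => n; have [] := en n.
Qed.

Lemma bnth_bcat (a : fpath) (x : bpath) (h : frng a = bsrc x) n :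
  bnth (bcat h) n =
  if (n < flen a)%N then onth (fedges a) n else bnth x (n - flen a)%N.
Proof.
case: x h => [p hp|y] h /=; first by rewrite onth_cat.
rewrite /flen; case: ltnP => hn; last by rewrite nth_default.
by rewrite onthE (nth_map (y (n - size (fedges a))%N)).
Qed.

Lemma bcat_inj (a : fpath) (x y : bpath) (h : frng a = bsrc x)
    (h' : frng a = bsrc y) : bcat h = bcat h' -> x = y.
Proof.
move=> e; apply: bpath_eq; first by rewrite -h -h'.
move=> n; have := congr1 (bnth^~ (flen a + n)%N) e.
by rewrite !bnth_bcat !ltnNge leq_addr /= addKn.
Qed.

Lemma bcatA (a b : fpath) (h : frng a = fsrc b) (x : bpath)
    (hb : frng b = bsrc x) (hab : frng (fcat h) = bsrc x)
    (ha : frng a = bsrc (bcat hb)) : bcat hab = bcat ha.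
Proof.
apply: bpath_eq; first by rewrite !bsrc_bcat.
move=> n; rewrite !bnth_bcat /flen /= size_cat onth_cat.
case: ltnP => h1; case: ltnP => h2 //.
- by rewrite ltn_subLR // h1.
- by rewrite ltnNge (leq_trans _ h1) ?leq_addr // in h2.
- by rewrite ltn_subLR // ltnNge h1 /= subnDA.
Qed.

Lemma fcatA (a b c : fpath) (h : frng a = fsrc b) (hb : frng b = fsrc c)
    (hab : frng (fcat h) = fsrc c) (ha : frng a = fsrc (fcat hb)) :
  fcat hab = fcat ha.
Proof. by apply: fpath_eq => //=; rewrite catA. Qed.

Lemma onth_prefix T (s t : seq T) : (size s <= size t)%N ->
  (forall n, (n < size s)%N -> onth s n = onth t n) ->
  t = s ++ drop (size s) t.
Proof.
elim: s t => [|x s IH] [|y t] //= le e.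
have [<-] := e 0%N isT; congr (_ :: _); apply: IH => // n; exact: (e n.+1).
Qed.

Lemma bcat_cmp (a b : fpath) (x y : bpath) (h : frng a = bsrc x)
    (h' : frng b = bsrc y) : bcat h = bcat h' -> (flen a <= flen b)%N ->
  exists d (hd : frng a = fsrc d) (hy : frng d = bsrc y),
    b = fcat hd /\ x = bcat hy.
Proof.
move=> e le.
have es : fsrc a = fsrc b by rewrite -(bsrc_bcat h) e bsrc_bcat.
have et : fedges b = fedges a ++ drop (flen a) (fedges b).
  apply: onth_prefix => // n ln; have := congr1 (bnth^~ n) e.
  by rewrite !bnth_bcat ln (leq_trans ln le).
have wd : walk (frng a) (drop (flen a) (fedges b)).
  by move: (fwalk b); rewrite -es {1}et => /walk_cat[].
pose d := FPath wd; have hd : frng a = fsrc d by [].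
have eb : b = fcat hd by apply: fpath_eq; [rewrite /= es|exact: et].
clearbody d; subst b; have hy : frng d = bsrc y by rewrite -h' frng_fcat.
have ha : frng a = bsrc (bcat hy) by rewrite bsrc_bcat.
by exists d, hd, hy; split=> //; apply: (bcat_inj (h := h) (h' := ha));
  rewrite e (bcatA _ ha).
Qed.

Lemma fcat_nil (a d : fpath) (h : frng a = fsrc d) : flen d = 0%N -> fcat h = a.
Proof.
by case: d h => v [|//] w h _; apply: fpath_eq => //=; rewrite cats0.
Qed.

Lemma cyl_sub (a b : fpath) w :
  cyl a w -> cyl b w -> (flen a <= flen b)%N -> cyl b `<=` cyl a.
Proof.
move=> [x [h ->]] [y [h' e]] le z [z' [hz ->]].
have [d [hd [hy [eb ex]]]] := bcat_cmp e le; subst b.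
have hd' : frng d = bsrc z' by rewrite -hz frng_fcat.
have ha : frng a = bsrc (bcat hd') by rewrite bsrc_bcat.
by exists (bcat hd'), ha; rewrite (bcatA _ ha).
Qed.

Lemma cyl_basis_cover : \bigcup_(B in cyl_basis) B = setT.
Proof.
apply/seteqP; split=> // z _.
pose a := @FPath (bsrc z) [::] I; have h : frng a = bsrc z by [].
exists (cyl a).
  exists a, set0; split; [exact: finite_set0|exact: sub0set|].
  by rewrite bigcup_set0 setD0.
exists z, h; apply: bpath_eq; first by rewrite bsrc_bcat.
by move=> n; rewrite bnth_bcat subn0.
Qed.

Lemma cyl_basis_join (A B : set bpath) z :
  cyl_basis A -> cyl_basis B -> A z -> B z ->
  exists C, [/\ cyl_basis C, C z & C `<=` A `&` B].
Proof.
suff aux (a b : fpath) (F G : set (edge E)) :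
    let A' := cyl a `\` \bigcup_(e in F)
      [set z | exists h : frng a = fsrc (fedge e), cyl (fcat h) z] in
    let B' := cyl b `\` \bigcup_(e in G)
      [set z | exists h : frng b = fsrc (fedge e), cyl (fcat h) z] in
    finite_set F -> F `<=` src @^-1` [set frng a] ->
    finite_set G -> G `<=` src @^-1` [set frng b] -> A' z -> B' z ->
    (flen a <= flen b)%N ->
    exists C, [/\ cyl_basis C, C z & C `<=` A' `&` B'].
  move=> [a [F [fF sF ->]]] [b [G [fG sG ->]]] Az Bz.
  have [le|/ltnW le] := leqP (flen a) (flen b); first exact: aux.
  have [C [bC Cz sC]] := aux b a G F fG sG fF sF Bz Az le.
  by exists C; split=> //; rewrite setIC.
move=> A' B' fF sF fG sG [[x [h ez] nz]] [[y [h' ez'] nz']] le.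
have zA : cyl a z by exists x, h.
have zB : cyl b z by exists y, h'.
have sAB := cyl_sub zA zB le.
move: (le); rewrite leq_eqVlt => /orP[/eqP eab|lt].
  have [|d [hd [hy [eb ex]]]] := bcat_cmp (h := h) (h' := h') _ le.
    by rewrite -ez -ez'.
  have {}eb : b = a.
    rewrite eb fcat_nil //; move: eab; rewrite eb /flen /= size_cat.
    by move=> /esym/eqP; rewrite -[eqbRHS]addn0 eqn_add2l => /eqP.
  exists (cyl a `\` \bigcup_(e in F `|` G)
    [set z | exists h : frng a = fsrc (fedge e), cyl (fcat h) z]); split.
  - exists a, (F `|` G); split=> //; first by rewrite finite_setU.
    by rewrite subUset; split=> //; rewrite -eb.
  - by split=> //; rewrite bigcup_setU => -[//|]; rewrite -eb.
  - by rewrite /A' /B' eb bigcup_setU setDUr.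
exists B'; split=> //; first by exists b, G.
rewrite subsetI; split=> // w [wB _]; split; first exact: sAB.
move=> [e Fe [he we]]; apply: nz; exists e => //; exists he.
by apply: (cyl_sub we wB) zB; rewrite /flen /= size_cat addn1.
Qed.

End GraphBasics.

HB.instance Definition _ (E : graph) := gen_eqMixin (bpath E).
HB.instance Definition _ (E : graph) := gen_choiceMixin (bpath E).
HB.instance Definition _ (E : graph) :=
  isBaseTopological.Build (bpath E) (@cyl_basis_cover E)
    (fun A B z bA bB => @cyl_basis_join E A B z bA bB).

Section Groupoid.
Variable E : graph.

(** The element $(x, k, y)$ has range $x$, degree $k$ and source $y$. *)
Record gpd : Type := Gpd {
  grng : bpath E;
  gdeg : int;
  gsrc : bpath E;
  gpdP : exists (a b : fpath E) (x : bpath E)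
           (ha : frng a = bsrc x) (hb : frng b = bsrc x),
         [/\ grng = bcat ha, gdeg = (flen a)%:Z - (flen b)%:Z
           & gsrc = bcat hb]
}.

Definition gpd_invariant (U : set (bpath E)) : Prop :=
  forall g : gpd, U (grng g) -> U (gsrc g).

(** [gcyl a b] is $Z(a, b)$. *)
Definition gcyl (a b : fpath E) : set gpd :=
  [set g | exists (x : bpath E) (ha : frng a = bsrc x) (hb : frng b = bsrc x),
     [/\ grng g = bcat ha, gdeg g = (flen a)%:Z - (flen b)%:Z
       & gsrc g = bcat hb]].

Definition gcyl_basis : set (set gpd) :=
  [set B | exists (a b : fpath E) (F : set (fpath E)),
     [/\ frng a = frng b, finite_set F, F `<=` [set c | fsrc c = frng a] &
         B = gcyl a b `\` \bigcup_(c in F)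
               [set g | exists (ha : frng a = fsrc c) (hb : frng b = fsrc c),
                  gcyl (fcat ha) (fcat hb) g]]].

Lemma gcyl_cmp (a b a' b' : fpath E) g :
  gcyl a b g -> gcyl a' b' g -> (flen a <= flen a')%N ->
  exists d (ha : frng a = fsrc d) (hb : frng b = fsrc d),
    a' = fcat ha /\ b' = fcat hb.
Proof.
move=> [x [h1 [h2 [e1 e2 e3]]]] [x' [h1' [h2' [e1' e2' e3']]]] le.
have leb : (flen b <= flen b')%N by move: e2; rewrite e2'; lia.
have [d [hd [hy [eb ex]]]] := bcat_cmp (etrans (esym e1) e1') le.
have [d' [hd' [hy' [eb' ex']]]] := bcat_cmp (etrans (esym e3) e3') leb.
have lend : flen d = flen d'.
  by move: e2; rewrite e2' eb eb' /flen /= !size_cat; lia.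
have dd' : d' = d.
  have [|k [hk [_ [ed' _]]]] := bcat_cmp (etrans (esym ex) ex').
    by rewrite lend.
  rewrite ed' fcat_nil //; move: lend; rewrite ed' /flen /= size_cat; lia.
by subst d'; exists d, hd, hd'.
Qed.

Lemma gcyl_fcat (a b c : fpath E) (ha : frng a = fsrc c) (hb : frng b = fsrc c) :
  gcyl (fcat ha) (fcat hb) `<=` gcyl a b.
Proof.
move=> g [x [h1 [h2 [e1 e2 e3]]]].
have hc : frng c = bsrc x by rewrite -h1 frng_fcat.
have h3 : frng a = bsrc (bcat hc) by rewrite bsrc_bcat.
have h4 : frng b = bsrc (bcat hc) by rewrite bsrc_bcat.
exists (bcat hc), h3, h4; split.
- by rewrite e1 (bcatA _ h3).
- by rewrite e2 /flen /= !size_cat; lia.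
- by rewrite e3 (bcatA _ h4).
Qed.

Lemma gcyl_basis_cover : \bigcup_(B in gcyl_basis) B = setT.
Proof.
apply/seteqP; split=> // g _.
have [a [b [x [ha [hb [e1 e2 e3]]]]]] := gpdP g.
exists (gcyl a b); last by exists x, ha, hb.
exists a, b, set0.
split; [by rewrite ha hb|exact: finite_set0|exact: sub0set|].
by rewrite bigcup_set0 setD0.
Qed.

Lemma gcyl_basis_join (A B : set gpd) g :
  gcyl_basis A -> gcyl_basis B -> A g -> B g ->
  exists C, [/\ gcyl_basis C, C g & C `<=` A `&` B].
Proof.
pose D (a b : fpath E) (F : set (fpath E)) := gcyl a b `\` \bigcup_(c in F)
  [set g | exists (ha : frng a = fsrc c) (hb : frng b = fsrc c),
     gcyl (fcat ha) (fcat hb) g].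
suff aux (a b a' b' : fpath E) (F G : set (fpath E)) :
    frng a = frng b -> finite_set F -> F `<=` [set c | fsrc c = frng a] ->
    frng a' = frng b' -> finite_set G -> G `<=` [set c | fsrc c = frng a'] ->
    D a b F g -> D a' b' G g -> (flen a <= flen a')%N ->
    exists C, [/\ gcyl_basis C, C g & C `<=` D a b F `&` D a' b' G].
  move=> [a [b [F [ab fF sF ->]]]] [a' [b' [G [ab' fG sG ->]]]] Ag Bg.
  have [le|/ltnW le] := leqP (flen a) (flen a'); first exact: aux.
  have [C [bC Cz sC]] := aux a' b' a b G F ab' fG sG ab fF sF Bg Ag le.
  by exists C; split=> //; rewrite setIC.
move=> ab fF sF ab' fG sG [gA nA] [gB nB] le.
have [d [ha [hb [ea eb]]]] := gcyl_cmp gA gB le; subst a' b'.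
(* the continuations of [d] that lie in [F] *)
pose F' := [set c | exists h : frng d = fsrc c, F (fcat h)].
have fF' : finite_set F'.
  pose f (c : fpath E) : seq (edge E) := drop (flen d) (fedges c).
  pose k (s : seq (edge E)) : set (fpath E) :=
    [set c | fsrc c = frng d /\ fedges c = s].
  apply: (@sub_finite_set _ _ (\bigcup_(c in F) k (f c))).
    move=> c [h Fc]; exists (fcat h) => //; split=> //.
    by rewrite /f /= drop_size_cat.
  apply: bigcup_finite => // c _.
  have [[c0 kc0]|nk] := pselect (k (f c) !=set0).
    apply: (@sub_finite_set _ _ [set c0]); last exact: finite_set1.
    move=> c1 [s1 w1]; case: kc0 => s0 w0.
    by apply: fpath_eq; [rewrite s1 s0|rewrite w1 w0].
  by move/nonemptyPn: nk => ->; exact: finite_set0.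
exists (D (fcat ha) (fcat hb) (F' `|` G)); split.
- exists (fcat ha), (fcat hb), (F' `|` G); split=> //.
    by rewrite finite_setU.
  by rewrite subUset; split=> // c [h _] /=; rewrite frng_fcat.
- split=> // -[c [[h Fc]|Gc] [hc1 [hc2 gc]]]; last first.
    by apply: nB; exists c => //; exists hc1, hc2.
  have h1 : frng a = fsrc (fcat h) by [].
  have h2 : frng b = fsrc (fcat h) by [].
  apply: nA; exists (fcat h) => //; exists h1, h2.
  by rewrite -(fcatA hc1) -(fcatA hc2).
move=> w [wB nw]; split; last first.
  by split=> // -[c Gc wc]; apply: nw; exists c => //; right.
split; first exact: gcyl_fcat wB.
move=> [c Fc [h1 [h2 wc]]].
have [lec|/ltnW lec] := leqP (flen d) (flen c).
  have [|d' [h1' [h2' [e1 e2]]]] := gcyl_cmp wB wc.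
    by rewrite /flen /= !size_cat leq_add2l.
  have h : frng d = fsrc d' by rewrite -h1' frng_fcat.
  have ec : c = fcat h.
    apply: fpath_eq; first by rewrite /= -ha -h1.
    have := congr1 (fun p => fedges p) e1; rewrite /= -catA.
    by move=> /(congr1 (drop (size (fedges a)))); rewrite !drop_size_cat.
  apply: nw; exists d'; first by left; exists h; rewrite -ec.
  by exists h1', h2'; rewrite -e1 -e2.
have [|d' [h1' [h2' [e1 e2]]]] := gcyl_cmp wc wB.
  by rewrite /flen /= !size_cat leq_add2l.
apply: nA; exists c => //; exists h1, h2.
by apply: (gcyl_fcat (ha := h1') (hb := h2')); rewrite -e1 -e2.
Qed.

End Groupoid.

HB.instance Definition _ (E : graph) := gen_eqMixin (gpd E).
HB.instance Definition _ (E : graph) := gen_choiceMixin (gpd E).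
HB.instance Definition _ (E : graph) :=
  isBaseTopological.Build (gpd E) (@gcyl_basis_cover E)
    (fun A B g bA bB => @gcyl_basis_join E A B g bA bB).

(** [f] restricts to a homeomorphism from [B] onto [f @` B], both sets with
    their subspace topologies. *)
Definition homeo_on (T U : topologicalType) (f : T -> U) (B : set T) : Prop :=
  [/\ set_inj B f, {within B, continuous f} &
      forall W, open W ->
        exists2 W', open W' & f @` (B `&` W) = f @` B `&` W'].

Definition open_bisection (E : graph) (B : set (gpd E)) : Prop :=
  [/\ open B,
      homeo_on (@grng E) B /\ open (@grng E @` B) &
      homeo_on (@gsrc E) B /\ open (@gsrc E @` B)].

Section Steinberg.
Variables (K : fieldType) (E : graph).

Definition steinberg : set (gpd E -> K^o) :=
  linear_span [set (\1_B : gpd E -> K^o) |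
                B in [set B | compact B /\ open_bisection B]].

(** The product of the Steinberg algebra; for [f] and [f'] in [steinberg] the
    sum has finitely many nonzero terms. A direct sum of ideals is a direct sum
    of the underlying subspaces, so [direct_sum] does not refer to it. *)
Definition convolution (f f' : gpd E -> K^o) : gpd E -> K^o := fun g =>
  \sum_(p \in [set p : gpd E * gpd E |
                [/\ gsrc p.1 = grng p.2, grng g = grng p.1,
                    gsrc g = gsrc p.2 & gdeg g = gdeg p.1 + gdeg p.2]])
    (f p.1 * f' p.2).

Definition steinberg_ideal (U : set (bpath E)) : set (gpd E -> K^o) :=
  [set f | steinberg f /\ @gsrc E @` [set g | f g != 0] `<=` U].

End Steinberg.
Arguments steinberg : clear implicits.
Arguments steinberg_ideal K {E} U.

Section Leavitt.
Variables (K : fieldType) (E : graph).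

Inductive lpa_gen : Type :=
| LVert of vert E
| LEdge of edge E
| LGhost of edge E.

Let V (v : vert E) : aterm K lpa_gen := AGen (LVert v).
Let e_ (e : edge E) : aterm K lpa_gen := AGen (LEdge e).
Let g_ (e : edge E) : aterm K lpa_gen := AGen (LGhost e).

(** In [lpa_ck2] the finite set $s^{-1}(v)$ is enumerated by [f]. *)
Inductive lpa_rel : aterm K lpa_gen -> aterm K lpa_gen -> Prop :=
| lpa_vv v : lpa_rel (AMul (V v) (V v)) (V v)
| lpa_vw v w : v <> w -> lpa_rel (AMul (V v) (V w)) AZero
| lpa_se e : lpa_rel (AMul (V (src e)) (e_ e)) (e_ e)
| lpa_er e : lpa_rel (AMul (e_ e) (V (rng e))) (e_ e)
| lpa_rg e : lpa_rel (AMul (V (rng e)) (g_ e)) (g_ e)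
| lpa_gs e : lpa_rel (AMul (g_ e) (V (src e))) (g_ e)
| lpa_ck1 e : lpa_rel (AMul (g_ e) (e_ e)) (V (rng e))
| lpa_ck1_neq e e' : e <> e' -> lpa_rel (AMul (g_ e) (e_ e')) AZero
| lpa_ck2 v n (f : 'I_n -> edge E) :
    regular v -> injective f -> range f = src @^-1` [set v] ->
    lpa_rel (V v)
      (\big[@AAdd K lpa_gen/AZero]_(i < n) AMul (e_ (f i)) (g_ (f i))).

Definition leavitt : assocAlgType K := palg lpa_rel.

End Leavitt.

(* Main.v *)
(** The groupoid conditions are treated through the topology of the boundary
    path space. Condition (iii) says that the boundary paths that enter [H] or
    end in a breaking vertex of [H] form a clopen set; conversely a clopen
    invariant [U] gives the set of vertices [v] with $Z(v) \subseteq U$.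

    The Leavitt path algebra acts on functions on (boundary paths) x [int], the
    integer recording degrees, and this action is faithful. If [L_K(E)] is the
    direct sum of [I] and [J], the [I]-component of a vertex commutes with all
    projections [a a^*], so it acts on each boundary path by an idempotent
    Laurent polynomial, that is by 0 or 1; the paths where it acts by 1 form a
    clopen invariant set. Conversely, for [U] clopen and invariant, $Z(v)$ is
    compact, so the indicator function of $Z(v) \cap U$ is the action of an
    element of [L_K(E)], and [L_K(E)] splits into the ideals acting by 0 off [U]
    and on [U]. *)

From HB Require Import structures.
From mathcomp Require Import all_boot all_order all_algebra.
From mathcomp Require Import all_classical topology numfun zify.
Require Import Defs.

Set Implicit Arguments.
Unset Strict Implicit.
Unset Printing Implicit Defensive.

Import GRing.Theory.
Local Open Scope classical_set_scope.

(** Singular vertices are the obstacle throughout. Near a finite path ending at an infinite emitter,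
    a neighbourhood can only be shrunk by excluding finitely many edges; breaking vertices and (b)
    record these exclusions, and (a) is the corresponding condition at infinite paths. In the
    algebra, a regular $v$ equals $\sum ee^*$, which lets an induction on the length of ghost parts
    prove faithfulness. At a sink or an infinite emitter this relation is missing, and the test
    object is the boundary path of length 0, which every $e^*$ annihilates. Since $L_K(E)$ need not
    have a unit, a decomposition is read off vertex by vertex and reassembled through local units.
    Clopenness comes from diagonal coefficients: $st^*$ returns a path to itself in degree 0 only if
    $s=t$, and then its coefficient is the indicator of a cylinder. *)

HB.instance Definition _ (E : graph) := gen_eqMixin (edge E).
HB.instance Definition _ (E : graph) := gen_choiceMixin (edge E).
HB.instance Definition _ (E : graph) := gen_eqMixin (vert E).
HB.instance Definition _ (E : graph) := gen_choiceMixin (vert E).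

HB.instance Definition _ (E : graph) := gen_eqMixin (fpath E).
HB.instance Definition _ (E : graph) := gen_choiceMixin (fpath E).

(** * Boundary paths *)

Section BoundaryPaths.
Variable E : graph.
Implicit Types (v w : vert E) (e : edge E) (s t : seq (edge E)).
Implicit Types (x y z : bpath E) (a : fpath E) (F : set (edge E)).

Definition ftail a : fpath E :=
  match a with
  | @FPath _ v [::] w => @FPath E v [::] I
  | @FPath _ v (e :: s) w => @FPath E (rng e) s (proj2 w)
  end.

Lemma frng_ftail a : frng (ftail a) = frng a.
Proof. by case: a => v [|e s] w. Qed.

Lemma ftail_singular a : sink (frng a) \/ inf_emitter (frng a) ->
  sink (frng (ftail a)) \/ inf_emitter (frng (ftail a)).
Proof. by rewrite frng_ftail. Qed.

(** The shift map; it fixes the paths of length 0. *)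
Definition bshift x : bpath E :=
  match x with
  | BFin a h => BFin (ftail_singular h)
  | BInf y => BInf (@IPath E (fun n => y n.+1) (fun n => iwalk y n.+1))
  end.

Lemma bnth_shift x n : bnth (bshift x) n = bnth x n.+1.
Proof. by case: x => [[v [|e s] w] h|y] //=; rewrite !onth_default. Qed.

Lemma bsrc_shift x e : bnth x 0 = Some e -> bsrc (bshift x) = rng e.
Proof.
case: x => [[v [|e' s] w] h|y] //= [<-] //.
by rewrite /isrc /= -iwalk.
Qed.

Lemma bshift_nil x : bnth x 0 = None -> bshift x = x.
Proof.
case: x => [[v [|e' s] w] h|y] //= _.
by apply: BFin_eq; apply: fpath_eq.
Qed.

Lemma bnth0_src x e : bnth x 0 = Some e -> src e = bsrc x.
Proof. by case: x => [[v [|e' s] w] h|y] //= [<-] //; case: (w). Qed.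

(** The value [x] on non-composable pairs is a default: it makes concatenation a plain [foldr], free
    of the equality proof that [bcat] carries. *)
Definition bcons e x : bpath E :=
  if pselect (rng e = bsrc x) is left h then @bcat E (fedge e) x h else x.

Lemma bcons_bnth e x n : rng e = bsrc x ->
  bnth (bcons e x) n = if n is n'.+1 then bnth x n' else Some e.
Proof.
rewrite /bcons; case: pselect => // h _; rewrite bnth_bcat /flen /=.
by case: n => [|n] //=; rewrite subSS subn0.
Qed.

Lemma bsrc_bcons e x : rng e = bsrc x -> bsrc (bcons e x) = src e.
Proof. by rewrite /bcons; case: pselect => // h _; rewrite bsrc_bcat. Qed.

Lemma bcons_shift x e : bnth x 0 = Some e -> bcons e (bshift x) = x.
Proof.
move=> h; have h' : rng e = bsrc (bshift x) by rewrite (bsrc_shift h).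
apply: bpath_eq; first by rewrite bsrc_bcons // (bnth0_src h).
by case=> [|n]; rewrite bcons_bnth // bnth_shift.
Qed.

Lemma bshift_cons e x : rng e = bsrc x -> bshift (bcons e x) = x.
Proof.
move=> h; apply: bpath_eq; first by rewrite (@bsrc_shift _ e) // bcons_bnth.
by move=> n; rewrite bnth_shift bcons_bnth.
Qed.

Lemma bnth_bcons0 e x : rng e = bsrc x -> bnth (bcons e x) 0 = Some e.
Proof. by move=> h; rewrite bcons_bnth. Qed.

Lemma bcons_inj e x y : rng e = bsrc x -> rng e = bsrc y ->
  bcons e x = bcons e y -> x = y.
Proof. by move=> hx hy h; rewrite -(bshift_cons hx) h bshift_cons. Qed.

(** A path is given by the list [s] of its edges and its range [w]. *)
Definition hd s w : vert E := if s is e :: _ then src e else w.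
Fixpoint comp s w : Prop :=
  if s is e :: s' then rng e = hd s' w /\ comp s' w else True.
Definition ucat s x : bpath E := foldr bcons x s.

Lemma bsrc_ucat s x : comp s (bsrc x) -> bsrc (ucat s x) = hd s (bsrc x).
Proof.
elim: s => //= e s IH [h1 h2]; rewrite bsrc_bcons // IH //.
Qed.

Lemma bnth_ucat s x n : comp s (bsrc x) ->
  bnth (ucat s x) n = if (n < size s)%N then onth s n else bnth x (n - size s).
Proof.
elim: s n => [|e s IH] n /=; first by rewrite subn0.
move=> [h1 h2]; rewrite bcons_bnth ?bsrc_ucat //.
by case: n => // n; rewrite IH.
Qed.

Lemma comp_walk s v : walk v s ->
  comp s (last v (map rng s)) /\ hd s (last v (map rng s)) = v.
Proof.
elim: s v => //= e s IH v [<- h]; have [h1 h2] := IH _ h.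
by rewrite h2.
Qed.

Lemma comp_fpath a : comp (fedges a) (frng a).
Proof. by have [] := comp_walk (fwalk a). Qed.

Lemma hd_fpath a : hd (fedges a) (frng a) = fsrc a.
Proof. by have [] := comp_walk (fwalk a). Qed.

Lemma walk_comp s w : comp s w ->
  walk (hd s w) s /\ last (hd s w) (map rng s) = w.
Proof.
elim: s => //= e s IH [h1 h2]; have [h3 h4] := IH h2.
by rewrite h1.
Qed.

Lemma fpath_of s w : comp s w ->
  exists a, [/\ fedges a = s, fsrc a = hd s w & frng a = w].
Proof. by move=> h; have [h1 h2] := walk_comp h; exists (FPath h1). Qed.

Lemma bcatE a x (h : frng a = bsrc x) : bcat h = ucat (fedges a) x.
Proof.
have c : comp (fedges a) (bsrc x) by rewrite -h; exact: comp_fpath.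
apply: bpath_eq; first by rewrite bsrc_bcat bsrc_ucat // -h hd_fpath.
by move=> n; rewrite bnth_bcat bnth_ucat.
Qed.

Lemma ucat_inj s x y : comp s (bsrc x) -> comp s (bsrc y) -> bsrc x = bsrc y ->
  ucat s x = ucat s y -> x = y.
Proof.
move=> cx cy exy h; apply: bpath_eq => // n.
have := congr1 (fun z => bnth z (size s + n)%N) h.
by rewrite !bnth_ucat // ltnNge leq_addr /= addKn.
Qed.

(** The first [n] edges, or all of them when there are fewer. *)
Fixpoint bedges x n : seq (edge E) :=
  if n is n'.+1 then
    if bnth x 0 is Some e then e :: bedges (bshift x) n' else [::]
  else [::].

Lemma walk_bedges x n : walk (bsrc x) (bedges x n).
Proof.
elim: n x => //= n IH x; case h: (bnth x 0) => [e|] //=.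
by rewrite (bnth0_src h) -(bsrc_shift h).
Qed.

Definition bpre x n : fpath E := FPath (walk_bedges x n).

Lemma bpre_split x n :
  frng (bpre x n) = bsrc (iter n bshift x) /\
  x = ucat (bedges x n) (iter n bshift x).
Proof.
rewrite /frng /=; elim: n x => //= n IH x; rewrite -iterS iterSr.
case h: (bnth x 0) => [e|] /=.
  have [h1 h2] := IH (bshift x).
  by rewrite -(bsrc_shift h) h1 -h2 bcons_shift.
suff -> : iter n bshift (bshift x) = x by [].
by rewrite -iterSr iterS; elim: n {IH} => [|m IHm] /=; [|rewrite IHm];
  exact: bshift_nil.
Qed.

Lemma comp_bedges x n : comp (bedges x n) (bsrc (iter n bshift x)).
Proof. by have [<- _] := bpre_split x n; exact: (comp_fpath (bpre x n)). Qed.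

Lemma size_bedges x n : (size (bedges x n) <= n)%N.
Proof. by elim: n x => //= n IH x; case: (bnth x 0) => [e|] //=; exact: IH. Qed.

Lemma size_bedges_inf (p : ipath E) n : size (bedges (BInf p) n) = n.
Proof. by elim: n p => //= n IH p; rewrite IH. Qed.

Lemma cylP a z : cyl a z <-> exists2 x, bsrc x = frng a & z = ucat (fedges a) x.
Proof.
split=> [[x [h ->]]|[x h ->]]; first by exists x; rewrite // bcatE.
by exists x, (esym h); rewrite bcatE.
Qed.

Lemma cyl_ucat a x : bsrc x = frng a -> cyl a (ucat (fedges a) x).
Proof. by move=> h; apply/cylP; exists x. Qed.

Lemma cyl_pref a z : cyl a z <->
  bsrc z = fsrc a /\ forall n, (n < flen a)%N -> bnth z n = onth (fedges a) n.
Proof.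
split=> [/cylP[x h ->]|].
  have c : comp (fedges a) (bsrc x) by rewrite h; exact: comp_fpath.
  split; first by rewrite bsrc_ucat // h hd_fpath.
  by move=> n nl; rewrite bnth_ucat // nl.
case: a => v s w; rewrite /flen /= => -[e h].
apply/cylP; rewrite /frng /=; elim: s v w z e h => [|e s IH] v w z ez h /=.
  by exists z.
have h0 : bnth z 0 = Some e by rewrite h.
have h' n : (n < size s)%N -> bnth (bshift z) n = onth s n.
  by move=> hn; rewrite bnth_shift h.
have [x ex zx] := IH _ (proj2 w) _ (bsrc_shift h0) h'.
by exists x => //; rewrite -zx bcons_shift.
Qed.

Definition fnil v : fpath E := @FPath E v [::] I.

Lemma cyl_nil v z : cyl (fnil v) z <-> bsrc z = v.
Proof. by rewrite cyl_pref; split=> [[]|h] //. Qed.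

Lemma cyl_bpre x n : cyl (bpre x n) x.
Proof.
by have [h1 h2] := bpre_split x n; rewrite {2}h2; apply: cyl_ucat; rewrite h1.
Qed.

Definition cylD a F : set (bpath E) :=
  [set z | cyl a z /\ forall e, F e -> bnth z (flen a) <> Some e].

Lemma cylD0 a : cylD a set0 = cyl a.
Proof. by apply/seteqP; split=> z; [case|split]. Qed.

Lemma cylDE a F : cyl a `\` \bigcup_(e in F)
    [set z | exists h : frng a = fsrc (fedge e), cyl (fcat h) z] = cylD a F.
Proof.
have key z e : cyl a z ->
    (exists h : frng a = fsrc (fedge e), cyl (fcat h) z) <->
    bnth z (flen a) = Some e.
  move=> az; split=> [[h]|h].
    move=> /cyl_pref[_ /(_ (flen a))]; rewrite /flen /= size_cat addn1 ltnSn.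
    by move=> -> //; rewrite onth_cat ltnn subnn.
  have h1 : frng a = fsrc (fedge e).
    have /cylP[x hx zx] := az; rewrite -hx; apply/esym; apply: bnth0_src.
    move: h; rewrite zx bnth_ucat ?ltnn ?subnn // hx; exact: comp_fpath.
  exists h1; apply/cyl_pref; have /cyl_pref[e1 e2] := az; split=> // n.
  rewrite /flen /= size_cat addn1 ltnS onth_cat leq_eqVlt.
  move=> /orP[/eqP ->|hn]; first by rewrite ltnn subnn.
  by rewrite e2 // hn.
apply/seteqP; split=> z [az h]; split=> //.
  by move=> e Fe ze; apply: h; exists e => //; apply/key.
by move=> [e Fe /(key _ _ az)]; apply: h.
Qed.

Lemma bpath_openE (A : set (bpath E)) :
  open A <-> exists2 D, D `<=` @cyl_basis E & \bigcup_(B in D) B = A.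
Proof. by []. Qed.

Lemma open_cylD a F : finite_set F -> open (cylD a F).
Proof.
move=> fF; apply/bpath_openE; exists [set cylD a F];
  last by rewrite bigcup_set1.
(* Only edges starting at [frng a] can follow [a], so dropping the others from [F] does not change
   the set. *)
move=> _ ->; exists a, (F `&` src @^-1` [set frng a]).
rewrite cylDE; split; [exact: finite_setIl|by move=> ? []|].
apply/seteqP; split=> z [az h]; split=> // e; first by case=> Fe _; apply: h.
move=> Fe ze; apply: (h e) (ze); split=> //=.
have /cylP[x hx zx] := az; rewrite -hx; apply: bnth0_src.
have <- : bnth z (flen a) = bnth x 0.
  by rewrite zx bnth_ucat ?ltnn ?subnn // hx; exact: comp_fpath.
exact: ze.
Qed.

End BoundaryPaths.

Arguments bshift {E}.

(** If no [f i] belonged to [G], all complements would, and so would their finite intersection,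
    which misses the union. *)
Lemma ultra_bigcup (T : Type) (I : choiceType) (G : set_system T) (D : set I)
    (f : I -> set T) : UltraFilter G -> finite_set D ->
  G (\bigcup_(i in D) f i) -> exists2 i, D i & G (f i).
Proof.
move=> UG fD GU; apply: contrapT => ne.
have : G (\bigcap_(i in D) ~` f i).
  move: fD ne {GU} => /finite_fsetP[X ->] ne; apply: filter_bigI => i iX.
  by have [Gi|//] := in_ultra_setVsetC (f i) UG; case: ne; exists i.
rewrite -setC_bigcup => GC.
by have [x []] := filter_ex (filterI GU GC).
Qed.

(** * Topology of the boundary path space *)

Section BoundaryTopology.
Variable E : graph.
Implicit Types (v w : vert E) (e : edge E) (s t : seq (edge E)).
Implicit Types (x z : bpath E) (a b p : fpath E) (F : set (edge E)).

Lemma bnth_iter_shift x n m : bnth (iter n bshift x) m = bnth x (n + m).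
Proof. by elim: n m => //= n IH m; rewrite bnth_shift IH addnS. Qed.

Lemma frng_bpre_inf (y : ipath E) n : frng (bpre (BInf y) n) = src (y n).
Proof.
have [-> _] := bpre_split (BInf y) n; apply/esym; apply: bnth0_src.
by rewrite bnth_iter_shift addn0.
Qed.

Lemma cyl_bnth a x y n : cyl a x -> cyl a y -> (n < flen a)%N ->
  bnth x n = bnth y n.
Proof. by move=> /cyl_pref[_ hx] /cyl_pref[_ hy] h; rewrite hx // hy. Qed.

(** A strictly longer prefix [b] also fixes the edge after [a], the only one that is tested against
    [F]. *)
Lemma cylD_cyl a F b x : cylD a F x -> cyl b x -> (flen a < flen b)%N ->
  cyl b `<=` cylD a F.
Proof.
move=> [ax nx] bx lt y y_b; split; last first.
  by move=> e Fe; rewrite -(cyl_bnth bx y_b lt); apply: nx.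
by apply: cyl_sub y y_b; [exact: ax|exact: bx|exact: ltnW].
Qed.

Lemma fpath_cyl a b x : cyl a x -> cyl b x -> flen a = flen b -> a = b.
Proof.
move=> ax bx eab; apply: fpath_eq.
  by have /cyl_pref[<- _] := ax; have /cyl_pref[<- _] := bx.
have h : fedges b = fedges a ++ drop (flen a) (fedges b).
  apply: onth_prefix; first by rewrite -/(flen a) eab.
  move=> n hn; have /cyl_pref[_ <-] := ax => //.
  by have /cyl_pref[_ <-] := bx; rewrite // -eab.
by rewrite h drop_oversize ?cats0 // eab.
Qed.

Lemma bpre_cyl a x : cyl a x -> bpre x (flen a) = a.
Proof.
move=> ax; apply: (fpath_cyl (cyl_bpre x (flen a)) ax).
rewrite /flen /=; have /cyl_pref[_ h] := ax; move: h; rewrite /flen.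
elim: (fedges a) {ax} x => //= e s IH x h.
have /= -> := h 0%N isT; rewrite /= IH // => n hn.
by rewrite bnth_shift (h n.+1).
Qed.

Lemma cyl_fin p hp : cyl p (@BFin E p hp).
Proof. exact/cyl_pref. Qed.

Lemma cyl_fin_le a p hp : cyl a (@BFin E p hp) -> (flen a <= flen p)%N.
Proof.
move=> /cyl_pref[_ h]; rewrite leqNgt; apply/negP => lt.
have /= := h _ lt; rewrite onth_default // => /esym.
by move: lt; rewrite /flen -onthTE => + eq; rewrite eq.
Qed.

Lemma nbhs_cylD x A : nbhs x A ->
  exists a F, [/\ finite_set F, cylD a F x & cylD a F `<=` A].
Proof.
rewrite nbhsE => -[B [/bpath_openE[D sD <-]] [C DC Cx] sBA].
have [a [F [fF _ eC]]] := sD _ DC.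
exists a, F; rewrite -cylDE -eC; split=> //.
by move=> y Cy; apply: sBA; exists C.
Qed.

(** A basic set around the path is built on a prefix [a] of [p]: either [a] is [p], or [a] is
    shorter and the basic set contains all of [cyl p]. *)
Lemma nbhs_fin p hp A : nbhs (@BFin E p hp) A ->
  exists2 F, finite_set F & cylD p F `<=` A.
Proof.
move=> /nbhs_cylD[a [F [fF ax sA]]].
have := cyl_fin_le (proj1 ax); rewrite leq_eqVlt => /orP[/eqP eap|lt].
  by exists F => //; rewrite -(fpath_cyl (proj1 ax) (cyl_fin hp) eap).
exists set0; first exact: finite_set0.
by rewrite cylD0; apply: subset_trans sA; apply: cylD_cyl ax (cyl_fin hp) lt.
Qed.

Lemma flen_bpre_inf (y : ipath E) n : flen (bpre (BInf y) n) = n.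
Proof. exact: size_bedges_inf. Qed.

Lemma nbhs_inf (y : ipath E) A : nbhs (BInf y) A ->
  exists n, forall m, (n <= m)%N -> cyl (bpre (BInf y) m) `<=` A.
Proof.
(* One edge beyond [a], so that the edge tested against [F] is fixed too. *)
move=> /nbhs_cylD[a [F [fF ax sA]]]; exists (flen a).+1 => m h.
apply: subset_trans sA; apply: cylD_cyl ax (cyl_bpre _ _) _.
by rewrite flen_bpre_inf.
Qed.

Lemma open_nbhsW (A : set (bpath E)) :
  (forall x, A x -> nbhs x A) -> open A.
Proof. by rewrite openE. Qed.

Lemma open_cyl a : open (cyl a).
Proof. by rewrite -cylD0; apply: open_cylD; exact: finite_set0. Qed.

Lemma nbhs_of_cylD a F x A : finite_set F -> cylD a F x -> cylD a F `<=` A ->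
  nbhs x A.
Proof.
move=> fF ax sA; rewrite nbhsE; exists (cylD a F) => //; split=> //.
exact: open_cylD.
Qed.

Lemma bnth_size_bedges x n : (size (bedges x n) < n)%N ->
  bnth x (size (bedges x n)) = None.
Proof.
elim: n x => //= n IH x; case h: (bnth x 0) => [e|] //=.
by rewrite ltnS => /IH; rewrite bnth_shift.
Qed.

Lemma closed_cyl a : closed (cyl a).
Proof.
rewrite -[cyl a]setCK closedC; apply: open_nbhsW => z.
have [esz|nsz] := pselect (bsrc z = fsrc a); last first.
  move=> _; apply: (@nbhs_of_cylD (fnil (bsrc z)) set0) => //.
    by rewrite cylD0; apply/cyl_nil.
  by rewrite cylD0 => y /cyl_nil ey /cyl_pref[ey' _]; apply: nsz; rewrite -ey.
move=> nz; have [n [lt ne]] : exists n, (n < flen a)%N /\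
    bnth z n <> onth (fedges a) n.
  apply: contrapT => h; apply: nz; apply/cyl_pref; split=> // n lt.
  by apply: contrapT => ne; apply: h; exists n.
(* [k] is [n], or the length of [z] if [z] ends earlier. Either way [z] does not have the edge [e]
   of [a] at position [k], and excluding [e] after the prefix of length [k] gives a neighbourhood of
   [z] disjoint from [cyl a]. *)
set k := flen (bpre z n).
have lek : (k <= n)%N by exact: size_bedges.
have ltk : (k < flen a)%N by exact: leq_ltn_trans lt.
have {}ne : bnth z k <> onth (fedges a) k.
  move: lek; rewrite leq_eqVlt => /orP[/eqP -> //|ltn].
  rewrite /k /flen bnth_size_bedges //.
  by move: ltk; rewrite /flen -onthTE; case: onth.
have [e he] : exists e, onth (fedges a) k = Some e.
  by move: ltk; rewrite /flen -onthTE; case: onth => // e; exists e.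
apply: (@nbhs_of_cylD (bpre z n) [set e]) => //.
  by split; [exact: cyl_bpre|move=> _ ->; rewrite -he].
by move=> y [_ ny] /cyl_pref[_ /(_ k ltk)]; rewrite he; apply: ny.
Qed.

Lemma clopen_cyl a : clopen (cyl a).
Proof. by split; [exact: open_cyl|exact: closed_cyl]. Qed.

Definition cylE a e : set (bpath E) :=
  [set z | cyl a z /\ bnth z (flen a) = Some e].

Lemma cyl_next a x e : cyl a x -> bnth x (flen a) = Some e -> src e = frng a.
Proof.
move=> ax; have /cylP[y hy ->] := ax.
rewrite bnth_ucat; last by rewrite hy; exact: comp_fpath.
by rewrite ltnn subnn => /bnth0_src ->.
Qed.

Lemma fsnocP a e : src e = frng a -> exists b,
  [/\ fsrc b = fsrc a, fedges b = rcons (fedges a) e, frng b = rng e &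
      cyl b = cylE a e].
Proof.
move=> h; have h1 : frng a = fsrc (fedge e) by [].
exists (fcat h1); rewrite frng_fcat /= cats1; split=> //.
apply/seteqP; split=> x.
  move=> /cyl_pref[hs hn]; split; last first.
    rewrite hn; last by rewrite /flen /= size_cat addn1.
    by rewrite onth_cat ltnn subnn.
  apply/cyl_pref; split=> // n ln; rewrite hn; last first.
    by rewrite /flen /= size_cat addn1 ltnW.
  by rewrite onth_cat ln.
move=> [/cyl_pref[hs hn] hx]; apply/cyl_pref; split=> // n.
rewrite /flen /= size_cat addn1 ltnS onth_cat leq_eqVlt.
by move=> /orP[/eqP ->|ln]; [rewrite ltnn subnn|rewrite hn ln].
Qed.

Definition snoc a b : Prop :=
  fsrc b = fsrc a /\ exists e, fedges b = rcons (fedges a) e.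

(** Dependent choice for boundary paths: [R] is preserved while edges are appended, and [S] marks
    where one may stop. If the iteration reaches [S], its first such stage is a finite boundary
    path; otherwise the stages are the prefixes of one infinite path. Compactness, existence of
    boundary paths and properness of [entering] all rest on it. *)
Lemma extend_path (R S : set (fpath E)) a0 :
  (forall p, S p -> sink (frng p) \/ inf_emitter (frng p)) ->
  (forall a, R a -> S a \/ exists2 b, snoc a b & R b) -> R a0 ->
  exists x, cyl a0 x /\
    ((exists p hp, [/\ x = @BFin E p hp, R p & S p]) \/
     (exists y : ipath E, x = BInf y /\ forall n, (flen a0 <= n)%N -> R (bpre x
       n))).
Proof.
move=> Ssing step R0.
have /choice[nxt nxtP] : forall a, exists b, R a -> ~ S a -> snoc a b /\ R b.
  move=> a; have [[Ra nSa]|h] := pselect (R a /\ ~ S a); last first.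
    by exists a => Ra nSa; case: h.
  by have [//|[b sab Rb]] := step _ Ra; exists b.
pose B n := iter n nxt a0.
have pref n : (forall m, (m < n)%N -> ~ S (B m)) ->
    [/\ R (B n), fsrc (B n) = fsrc a0, flen (B n) = (flen a0 + n)%N &
        forall m, (m <= n)%N -> exists s, fedges (B n) = fedges (B m) ++ s].
  elim: n => [|n IH] h.
    rewrite addn0; split=> // m; rewrite leqn0 => /eqP ->.
    by exists [::]; rewrite cats0.
  have [|Rn sn ln pn] := IH; first by move=> m /leqW; apply: h.
  have [[s1 [e s2]] R1] := nxtP _ Rn (h n (ltnSn n)).
  split=> //; first by rewrite -[B n.+1]/(nxt (B n)) s1 sn.
    by rewrite /flen s2 size_rcons -/(flen _) ln addnS.
  move=> m; rewrite leq_eqVlt => /orP[/eqP ->|]; first by exists [::];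
    rewrite cats0.
  by move=> /pn[s es]; exists (rcons s e); rewrite s2 es rcons_cat.
have [[n Sn]|nS] := pselect (exists n, S (B n)).
  have ex : exists n, `[< S (B n) >] by exists n; apply/asboolP.
  case: (ex_minnP ex) => {}n /asboolP {}Sn nmin.
  have [m hm|Rn sn ln pn] := pref n.
    by move=> /asboolP /nmin; rewrite leqNgt hm.
  have [s es] := pn 0%N (leq0n n).
  exists (BFin (Ssing _ Sn)); split; last by left; exists (B n), (Ssing _ Sn).
  by apply/cyl_pref; split=> //= m ml; rewrite es onth_cat ml.
have {}nS n : ~ S (B n) by move=> Sn; apply: nS; exists n.
have {}pref n := pref n (fun m _ => nS m).
have lB n : (n < flen (B n.+1))%N by have [_ _ -> _] := pref n.+1;
  rewrite addnS ltnS leq_addl.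
have /choice[f fP] : forall n, exists e, onth (fedges (B n.+1)) n = Some e.
  move=> n; have := lB n; rewrite /flen -onthTE; case: onth => // e _.
  by exists e.
have fB n m : (m < flen (B n))%N -> onth (fedges (B n)) m = Some (f m).
  move=> mn; have [le|lt] := leqP n m.
    have [_ _ _ /(_ n)[|s es]] := pref m.+1; first exact: leqW.
    by rewrite -fP es onth_cat mn.
  have [_ _ _ /(_ m.+1)[//|s es]] := pref n.
  by rewrite -fP es onth_cat lB.
(* Both edges occur, consecutively, in the walk [B n.+2]. *)
have fw n : rng (f n) = src (f n.+1).
  have l2 := lB n.+1; have l1 := ltnW l2.
  have := fwalk (B n.+2); have := fB _ _ l2; have := fB _ _ l1.
  move: (fedges _) (fsrc _) (f n) (f n.+1) => s v e1 e2.
  elim: s v n {l1 l2} => // e s IH v [|n] /=.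
    by move=> [<-]; case: s {IH} => // e' s /= [<-] [_ [->]].
  by move=> h1 h2 [_ h3]; exact: IH h1 h2 h3.
pose y := @IPath E f fw.
have cB n : cyl (B n) (BInf y).
  apply/cyl_pref; split; last by move=> m mn; rewrite fB.
  have [_ -> _ _] := pref n; have [_ <- _ _] := pref 1%N.
  have := fwalk (B 1%N); have := fP 0%N; rewrite -[bsrc _]/(src (f 0%N)).
  by case: (fedges _) => // e s [<-] [].
exists (BInf y); split; first exact: (cB 0%N).
right; exists y; split=> // n /subnKC <-.
have [Rn _ <- _] := pref (n - flen a0)%N.
by rewrite bpre_cyl.
Qed.

Lemma snoc_exists a e : src e = frng a ->
  exists2 b, snoc a b & frng b = rng e /\ cyl b = cylE a e.
Proof.
by move=> /fsnocP[b [h1 h2 h3 h4]]; exists b => //; split=> //; exists e.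
Qed.

Lemma regular_next a : regular (frng a) ->
  cyl a = \bigcup_(e in src @^-1` [set frng a]) cylE a e.
Proof.
move=> reg; apply/seteqP; split=> x; last by move=> [e _ []].
move=> ax; case h: (bnth x (flen a)) => [e|].
  by exists e => //; exact: cyl_next ax h.
case: x ax h => // p hp ax /=.
rewrite /flen => h; have := cyl_fin_le ax; rewrite leq_eqVlt => /orP[/eqP eap|].
  by exfalso; move: (hp); rewrite -(fpath_cyl ax (cyl_fin hp) eap); case: reg;
    tauto.
by rewrite /flen -onthTE h.
Qed.

(** Follow an ultrafilter [G] down the tree of paths, keeping the cylinder in [G]. At a regular
    vertex the cylinder splits into finitely many, one of which is in [G]. If no extension is in
    [G], the vertex is singular, and the complements of the extensions are in [G]; hence so is every
    $Z(p\setminus F)$, and [G] converges to [p]. *)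
Lemma compact_cyl a : compact (cyl a).
Proof.
rewrite compact_ultra => G UG Ga.
have [|||x [ax hx]] := @extend_path [set b | G (cyl b)]
  [set b | (sink (frng b) \/ inf_emitter (frng b)) /\
           forall e, ~ G (cylE b e)] a.
- by move=> p [].
- move=> b Gb; have [[e Ge]|ne] := pselect (exists e, G (cylE b e)).
    right; have [x [bx hx]] := filter_ex Ge.
    by have [c sc [_ ec]] := snoc_exists (cyl_next bx hx); exists c;
      rewrite //= ec.
  left; split; last by move=> e Ge; apply: ne; exists e.
  apply: contrapT => /not_orP reg; have reg' : regular (frng b) by split; tauto.
  have fin : finite_set (src @^-1` [set frng b]) by apply: contrapT; tauto.
  move: Gb; rewrite /= (regular_next reg') => /(ultra_bigcup UG fin)[e _ Ge].
  by apply: ne; exists e.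
- exact: Ga.
exists x; split=> // A; case: hx => [[p [hp [-> Gp [_ nS]]]]|[y [-> hy]]].
  move=> /nbhs_fin[F fF sA]; apply: filterS sA _.
  have GC e : G (~` cylE p e).
    by have [/nS|] := in_ultra_setVsetC (cylE p e) UG.
  have : G (cyl p `&` \bigcap_(e in F) ~` cylE p e).
    apply: filterI => //; move: fF => /finite_fsetP[X ->].
    by apply: filter_bigI => e _.
  apply: filterS => z [pz hz]; split=> // e Fe ze.
  by apply: (hz e Fe).
move=> /nbhs_inf[n hn]; apply: filterS (hn (maxn n (flen a)) (leq_maxl _ _)) _.
by apply: hy; exact: leq_maxr.
Qed.
End BoundaryTopology.

Lemma properTP (T : Type) (A : set T) : A `<` setT <-> exists x, ~ A x.
Proof.
split=> [[_ nA]|[x nAx]]; last by split=> // /(_ x I).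
by apply: contrapT => ne; apply: nA => x _; apply: contrapT => nAx; apply: ne;
  exists x.
Qed.

Lemma infinite_notin (T : Type) (A B : set T) : infinite_set A -> finite_set B
  ->
  exists2 x, A x & ~ B x.
Proof.
move=> iA fB; apply: contrapT => ne; apply: iA;
  apply: sub_finite_set fB => x Ax.
by apply: contrapT => nB; apply: ne; exists x.
Qed.

(** * Invariant sets and sets of vertices *)

Section Invariant.
Variable E : graph.
Implicit Types (v w : vert E) (e : edge E) (s t : seq (edge E)).
Implicit Types (x z : bpath E) (a b p : fpath E) (F : set (edge E)).
Implicit Types (U V : set (bpath E)) (H : set (vert E)).

Lemma cyl_split a x : cyl a x -> exists z,
  [/\ bsrc z = frng a, x = ucat (fedges a) z & bnth z 0 = bnth x (flen a)].
Proof.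
move=> /cylP[z hz ->]; exists z; split=> //.
by rewrite bnth_ucat ?ltnn ?subnn // hz; exact: comp_fpath.
Qed.

Lemma gpd_exists s t x : comp s (bsrc x) -> comp t (bsrc x) ->
  exists g : gpd E, grng g = ucat s x /\ gsrc g = ucat t x.
Proof.
move=> /fpath_of[a [<- _ ha]] /fpath_of[b [<- _ hb]].
have P : exists (a' b' : fpath E) (x' : bpath E) (h : frng a' = bsrc x')
    (h' : frng b' = bsrc x'), [/\ ucat (fedges a) x = bcat h,
    ((flen a)%:Z - (flen b)%:Z)%R = ((flen a')%:Z - (flen b')%:Z)%R &
    ucat (fedges b) x = bcat h'].
  by exists a, b, x, ha, hb; rewrite !bcatE.
by exists (Gpd P).
Qed.

Lemma invariant_ucat U s x : gpd_invariant U -> comp s (bsrc x) ->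
  U (ucat s x) <-> U x.
Proof.
move=> inv c; have [g [g1 g2]] := @gpd_exists s [::] x c I.
have [g' [g1' g2']] := @gpd_exists [::] s x I c.
split=> h; first by have := inv g; rewrite g1 g2; apply.
by have := inv g'; rewrite g1' g2'; apply.
Qed.

(** An arrow joins some $\alpha x$ to $\beta x$; the edges of $\alpha$ are removed and those of
    $\beta$ added one at a time. *)
Lemma invariant_edge U : (forall e x, rng e = bsrc x -> U (bcons e x) <-> U x)
  ->
  gpd_invariant U.
Proof.
move=> h; have h' s x : comp s (bsrc x) -> U (ucat s x) <-> U x.
  elim: s => //= e s IH [h1 h2]; rewrite -(IH h2); apply: h.
  by rewrite bsrc_ucat.
move=> g; have [a [b [x [ha [hb [-> _ ->]]]]]] := gpdP g; rewrite !bcatE.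
move=> /h' Ux; apply/h'; first by rewrite -hb; exact: comp_fpath.
by apply: Ux; rewrite -ha; exact: comp_fpath.
Qed.

Lemma invariantC U : gpd_invariant U -> gpd_invariant (~` U).
Proof.
move=> inv; apply: invariant_edge => e x h.
have := @invariant_ucat U [:: e] x inv; rewrite /= => -[] //.
by rewrite /setC /=; tauto.
Qed.

Lemma bpath_exists v : exists x, bsrc x = v.
Proof.
have [|||x [/cyl_nil vx _]] := @extend_path E setT
  [set p | sink (frng p) \/ inf_emitter (frng p)] (fnil v).
- by [].
- move=> a _; have [s|/not_orP[ns _]] := pselect (sink (frng a) \/ inf_emitter
  (frng a)).
    by left.
  right; have [e he] : exists e, src e = frng a.
    by apply: contrapT => ne; apply: ns; apply/seteqP; split=> // e he;
      apply: ne; exists e.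
  by have [b sb _] := snoc_exists he; exists b.
- by [].
- by exists x.
Qed.

Definition inside U : set (vert E) := [set v | forall z, bsrc z = v -> U z].

(** * From a clopen invariant set of paths to a set of vertices *)

Section FromOpen.
Variable U : set (bpath E).
Hypotheses (oU : open U) (inv : gpd_invariant U).

Lemma inside_cyl a : cyl a `<=` U <-> inside U (frng a).
Proof.
have c z : bsrc z = frng a -> comp (fedges a) (bsrc z).
  by move=> ->; exact: comp_fpath.
split=> [sa z hz|h z /cylP[x hx ->]].
  by apply/(invariant_ucat inv (c z hz)); apply: sa; exact: cyl_ucat.
by apply/(invariant_ucat inv (c x hx)); apply: h.
Qed.

Lemma inside_hereditary : hereditary (inside U).
Proof.
move=> p h z hz.
have c : comp (fedges p) (bsrc z) by rewrite hz; exact: comp_fpath.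
apply/(invariant_ucat inv c); apply: h.
by rewrite bsrc_ucat // hz hd_fpath.
Qed.

Lemma inside_saturated : saturated (inside U).
Proof.
move=> v reg sub z hz.
have : cyl (fnil v) z by exact/cyl_nil.
rewrite (@regular_next _ (fnil v)) // => -[e /= es [_ ez]].
rewrite -(bcons_shift ez); apply/(@invariant_ucat U [:: e]) => //=.
  by rewrite (bsrc_shift ez).
by apply: (sub (rng e)); [exists e|rewrite (bsrc_shift ez)].
Qed.

Lemma cylE_inside a e : src e = frng a -> cylE a e `<=` U <-> inside U (rng e).
Proof.
by move=> /fsnocP[b [_ _ <- <-]]; exact: inside_cyl.
Qed.

(** Infinite paths and paths ending in sinks have full cylinders as small neighbourhoods, and a
    cylinder inside [U] puts its end vertex into [inside U]. Only at an infinite emitter can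
    excluded edges remain; this is the origin of breaking vertices. *)
Lemma open_inside x : U x ->
  (exists n, inside U (frng (bpre x n))) \/
  (exists p hp, [/\ x = @BFin E p hp, inf_emitter (frng p) &
     exists2 F, finite_set F & cylD p F `<=` U]).
Proof.
move=> Ux; have : nbhs x U by exact: open_nbhs_nbhs.
case: x Ux => [p hp|y] Ux.
  move=> /nbhs_fin[F fF sU]; have [sp|ip] := hp; last by right; exists p, hp;
    split=> //; exists F.
  left; exists (flen p); rewrite (bpre_cyl (cyl_fin hp)); apply/inside_cyl.
  apply: subset_trans sU => z pz; split=> // e Fe /(cyl_next pz) he.
  by have : set0 e by rewrite -sp.
move=> /nbhs_inf[n /(_ n (leqnn _)) sU]; left; exists n; exact/inside_cyl.
Qed.

Lemma inside_edge p F : inf_emitter (frng p) -> finite_set F ->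
  cylD p F `<=` U -> forall e, src e = frng p -> ~ F e -> inside U (rng e).
Proof.
move=> ip fF sU e he nF; apply/(cylE_inside he); apply: subset_trans sU.
by move=> z [pz ze]; split=> // e' Fe'; rewrite ze => -[ee']; apply: nF;
  rewrite ee'.
Qed.

Lemma inside_nonempty : U !=set0 -> inside U !=set0.
Proof.
move=> [x /open_inside[[n h]|[p [hp [_ ip [F fF sU]]]]]]; first by eexists;
  exact: h.
have [e he nF] := infinite_notin ip fF.
by exists (rng e); exact: inside_edge sU e he nF.
Qed.

(** The local form of (a) and (b). If [cyl a] avoids [U], no path leads from the end of [a] to
    [inside U]: prolonging it to a boundary path would give, by invariance, a point of [cyl a] in
    [U]. At a finite path, [inside U] can therefore be reached only through the finitely many
    excluded edges. *)
Lemma outside_paths z : ~ U z -> nbhs z (~` U) ->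
  (forall y, z = BInf y -> exists n, paths (frng (bpre z n)) (inside U) = set0)
    /\
  (forall p hp, z = @BFin E p hp ->
    finite_set [set e | src e = frng p /\ paths (rng e) (inside U) !=set0]).
Proof.
move=> nU nb.
have key a (q : fpath E) : cyl a `<=` ~` U -> fsrc q = frng a ->
    ~ inside U (frng q).
  move=> sa hq h; have [x hx] := bpath_exists (frng q).
  have c : comp (fedges q) (bsrc x) by rewrite hx; exact: comp_fpath.
  have hs : bsrc (ucat (fedges q) x) = frng a.
    by rewrite bsrc_ucat // hx hd_fpath.
  have := sa _ (cyl_ucat hs); apply; apply/(invariant_ucat inv).
    by rewrite hs; exact: comp_fpath.
  by apply/(invariant_ucat inv c); exact: h.
split=> [y ez|p hp ez]; move: nb; rewrite ez.
  move=> /nbhs_inf[n /(_ n (leqnn _)) sn]; exists n.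
  by apply/seteqP; split=> // q [hq]; exact: key sn hq.
move=> /nbhs_fin[F fF sF]; apply: sub_finite_set fF => e [he [q [hq Hq]]].
apply: contrapT => nF; have [b [_ _ rb cb]] := fsnocP he.
apply: (key b q) Hq; last by rewrite rb.
rewrite cb; apply: subset_trans sF => x [px ex]; split=> // e' Fe'.
by rewrite ex => -[ee']; apply: nF; rewrite ee'.
Qed.

End FromOpen.

Definition splitting H : Prop :=
  [/\ H !=set0, H `<` setT, hereditary H & saturated H] /\
         (forall x : ipath E, ivertices x `<=` ~` H ->
            exists N : nat, paths (rng (x N)) H = set0) /\
         (forall v : vert E,
            infinite_set [set e : edge E | src e = v /\
                                           paths (rng e) H !=set0] ->
            (H `|` breaking H) v).

Lemma clopen_splitting U : U !=set0 -> U `<` setT -> clopen U -> gpd_invariant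
  U ->
  splitting (inside U).
Proof.
move=> U0 /properTP[z nUz] [oU cU] inv.
have nb x : ~ U x -> nbhs x (~` U).
  by move=> nUx; apply: open_nbhs_nbhs; split=> //; exact: closed_openC.
split; last split.
- split; [exact: inside_nonempty| |exact: inside_hereditary|exact:
  inside_saturated].
  apply/properTP; exists (bsrc z) => // h; exact/nUz/h.
- move=> x sx; have nUx : ~ U (BInf x).
    move=> /(open_inside oU inv)[[n]|[p [hp []]]] //; rewrite frng_bpre_inf.
    by apply: sx; case: n => [|n]; [left|right; exists n => //; exact: iwalk].
  have [/(_ x erefl)[n e0] _] := outside_paths inv nUx (nb _ nUx).
  (* [outside_paths] concerns $s(x_n)$ while (a) concerns $r(x_n)$: prefix the edge [x n] to a path
     from the latter. *)
  exists n; apply/seteqP; split=> // q [hq Hq].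
  have [b sb rb] : exists2 b : fpath E, fsrc b = src (x n) & frng b = frng q.
    have h : frng (fedge (x n)) = fsrc q by rewrite hq.
    by exists (fcat h); rewrite ?frng_fcat.
  have : paths (frng (bpre (BInf x) n)) (inside U) b.
    by split; rewrite ?frng_bpre_inf // rb.
  by rewrite e0.
- move=> v inf.
  have iv : inf_emitter v by move=> fv; apply: inf;
    apply: sub_finite_set fv => e [].
  (* The path of length 0 at [v] decides: outside [U] it contradicts [inf]; in [U] it forces all but
     finitely many edges at [v] to lead into [inside U]. *)
  pose hp : sink (frng (fnil v)) \/ inf_emitter (frng (fnil v)) := or_intror iv.
  have [Uv|nUv] := pselect (U (BFin hp)); last first.
    have [_ /(_ _ _ erefl)] := outside_paths inv nUv (nb _ nUv).
    by move=> /inf.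
  have [F fF sU] : exists2 F, finite_set F & cylD (fnil v) F `<=` U.
    by apply: (nbhs_fin (hp := hp)); exact: open_nbhs_nbhs.
  have hF := inside_edge (p := fnil v) inv iv fF sU.
  have [Hv|nHv] := pselect (inside U v); [by left|right; split=> //].
    (* If every edge at [v] led into [inside U], all paths from [v] would lie in [U]: the trivial
       one by [Uv], the others by invariance. *)
    apply: contrapT => ne; apply: nHv => z0 hz.
    case ez: (bnth z0 0) => [e|]; last first.
      suff -> : z0 = BFin hp by [].
      case: z0 hz ez => // p hp' hz ez; apply: BFin_eq; apply: fpath_eq => //.
      by move: ez => /=; case: (fedges p).
    rewrite -(bcons_shift ez); apply/(@invariant_ucat U [:: e]) => //=.
      by rewrite (bsrc_shift ez).
    apply: contrapT => nU; apply: ne; exists e; split=> /=; last first.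
      by move=> h; apply: nU; apply: h; rewrite (bsrc_shift ez).
    by rewrite (bnth0_src ez).
  apply: sub_finite_set fF => e [he nH].
  by apply: contrapT => nF; apply: nH; exact: hF.
Qed.

(** * From a set of vertices to a clopen invariant set of paths *)

Section FromVertices.
Variable H : set (vert E).

Definition ends_in x : Prop := H (bsrc x) \/ bnth x 0 = None /\ breaking H
  (bsrc x).

Definition entering : set (bpath E) :=
  [set x | exists n, ends_in (iter n bshift x)].

Hypothesis hH : splitting H.

Lemma hereditary_edge e : H (src e) -> H (rng e).
Proof. by case: hH => [[_ _ h _] _] he; exact: (h (fedge e)). Qed.

Lemma entering_invariant : gpd_invariant entering.
Proof.
apply: invariant_edge => e x h; split=> -[n hn]; last first.
  by exists n.+1; rewrite iterSr bshift_cons.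
case: n hn => [|n]; last by rewrite iterSr bshift_cons //; exists n.
move=> [|[]] /=; last by rewrite bnth_bcons0.
rewrite bsrc_bcons // => /hereditary_edge; rewrite h => h'.
by exists 0%N; left.
Qed.

Lemma entering_ucat a x : bsrc x = frng a ->
  entering (ucat (fedges a) x) <-> entering x.
Proof.
move=> h; apply: invariant_ucat; first exact: entering_invariant.
by rewrite h; exact: comp_fpath.
Qed.

Lemma iter_shift_nil x n : bnth x 0 = None -> iter n bshift x = x.
Proof. by move=> h; elim: n => //= n ->; exact: bshift_nil. Qed.

Lemma entering_nil x : bnth x 0 = None -> entering x -> ends_in x.
Proof. by move=> h [n]; rewrite iter_shift_nil. Qed.

Lemma breaking_edge v : breaking H v -> exists2 e, src e = v & H (rng e).
Proof.
move=> [_ iv _ fv]; have [e he ne] := infinite_notin iv fv; exists e => //.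
by apply: contrapT => nH; apply: ne.
Qed.

Lemma entering_paths x : entering x -> paths (bsrc x) H !=set0.
Proof.
move=> [n]; have [eb _] := bpre_split x n;
  case=> [h|[_ /breaking_edge[e he h]]].
  by exists (bpre x n); split=> //; rewrite eb.
rewrite -eb in he; have [b [sb _ rb _]] := fsnocP he.
by exists b; split; rewrite ?sb // rb.
Qed.

Lemma entering_open : open entering.
Proof.
apply: open_nbhsW => x [n]; have [eb ex] := bpre_split x n;
  rewrite /ends_in -eb.
case=> [h|[nn br]].
  apply: (@nbhs_of_cylD _ (bpre x n) set0) => //; rewrite cylD0.
    exact: cyl_bpre.
  move=> y /cylP[z hz ->]; apply/entering_ucat => //.
  by exists 0%N; left; rewrite /= hz.
(* The excluded edges are those from the breaking vertex to the complement of [H], finitely many by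
   definition; a continuation then enters [H] at once or stops there. *)
have [_ _ _ fF] := br; apply: (nbhs_of_cylD fF).
  split; first exact: cyl_bpre.
  move=> e _; suff -> : bnth x (flen (bpre x n)) = None by [].
  rewrite {1}ex bnth_ucat; last exact: comp_bedges.
  by rewrite ltnn subnn.
move=> y [/cyl_split[z [hz -> ez]] ny]; apply/entering_ucat => //.
case e0: (bnth z 0) => [e|]; last by exists 0%N; right; rewrite /= hz.
exists 1%N; left; rewrite /= (bsrc_shift e0); apply: contrapT => nH.
apply: (ny e); first by split=> //=; rewrite (bnth0_src e0) hz.
by rewrite -e0 ez bnth_ucat ?ltnn ?subnn // hz; exact: comp_fpath.
Qed.

(** At a finite path outside [entering], the end vertex is neither in [H] nor breaking, so by (b)
    only finitely many of its edges can reach [H], and these are excluded. At an infinite path, (a)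
    provides a prefix after which [H] is out of reach. *)
Lemma entering_closed : closed entering.
Proof.
rewrite -[entering]setCK closedC; apply: open_nbhsW => -[p hp|y] nU.
  have e0 : exists z, [/\ bsrc z = frng p, BFin hp = ucat (fedges p) z & bnth z
    0 = None].
    have [z [h1 h2 h3]] := cyl_split (cyl_fin hp).
    by exists z; split=> //; rewrite h3 /= onth_default.
  have [z0 [hz0 ez0 nz0]] := e0.
  have nz : ~ ends_in z0.
    by move=> h; apply: nU; rewrite ez0; apply/entering_ucat => //; exists 0%N.
  pose F := [set e | src e = frng p /\ paths (rng e) H !=set0].
  have fF : finite_set F.
    apply: contrapT => iF; apply: nz; case: hH => _ [_ /(_ _ iF)].
    by rewrite /ends_in hz0 => -[]; [left|right].
  apply: (nbhs_of_cylD fF).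
    by split=> [|e _ /=]; [exact: cyl_fin|rewrite onth_default].
  move=> y [/cyl_split[z [hz -> ez]] ny] /entering_ucat h.
  move/(_ hz) in h; case e1: (bnth z 0) => [e|]; last first.
    by apply: nz; have := entering_nil e1 h; rewrite /ends_in nz0 e1 hz hz0.
  apply: (ny e); last first.
    by rewrite -e1 ez bnth_ucat ?ltnn ?subnn // hz; exact: comp_fpath.
  split; first by rewrite (bnth0_src e1).
  rewrite -(bsrc_shift e1); apply: entering_paths.
  apply/(@invariant_ucat _ [:: e] _ entering_invariant) => /=.
    by rewrite (bsrc_shift e1).
  by rewrite bcons_shift.
have nH n : ~ H (src (y n)).
  move=> h; apply: nU; exists n; left;
    suff <- : src (y n) = bsrc (iter n bshift (BInf y)) by [].
  by apply: bnth0_src; rewrite bnth_iter_shift addn0.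
have [_ [hy _]] := hH; have [|N e0] := hy y.
  by move=> _ [->|[n _ <-]]; rewrite ?iwalk; exact: nH.
(* The prefix with [N.+1] edges ends at [rng (y N)], the vertex named in (a). *)
apply: (@nbhs_of_cylD _ (bpre (BInf y) N.+1) set0) => //; rewrite cylD0.
  exact: cyl_bpre.
move=> x /cylP[z hz ->] /entering_ucat h; have [q] := entering_paths (h hz).
by rewrite hz frng_bpre_inf -iwalk e0.
Qed.

Lemma entering_nonempty : entering !=set0.
Proof.
case: hH => [[[v Hv] _ _ _] _]; have [x hx] := bpath_exists v.
by exists x, 0%N; left; rewrite hx.
Qed.

(** Starting outside [H], one can stay outside: a regular vertex has an edge avoiding [H] by
    saturation, a breaking vertex by definition, and at any other singular vertex the path may
    stop. *)
Lemma entering_proper : entering `<` setT.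
Proof.
case: hH => [[_ /properTP[v nHv] _ sat] _].
have [|||x [_ hx]] := @extend_path E [set a | ~ H (frng a)]
  [set a | (sink (frng a) \/ inf_emitter (frng a)) /\ ~ breaking H (frng a)]
    (fnil v).
- by move=> p [].
- move=> a nHa; set S := (X in X a).
  have [Sa|nS] := pselect (S a); [by left|right].
  have [e he nHe] : exists2 e, src e = frng a & ~ H (rng e).
    have [br|nbr] := pselect (breaking H (frng a)).
      by have [_ _ [e [he nH]] _] := br; exists e.
    apply: contrapT => ne; apply: nHa; apply: sat.
      by split=> h; apply: nS; split=> //; [left|right].
    by move=> _ [e he <-]; apply: contrapT => nH; apply: ne; exists e.
  by have [b sb [rb _]] := snoc_exists he; exists b; rewrite //= rb.
- exact: nHv.
apply/properTP; exists x => //.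
case: hx => [[p [hp [-> nHp [_ nbr]]]]|[y [-> hy]]].
  have [z [hz ez nz]] := cyl_split (cyl_fin hp).
  rewrite ez => /(entering_ucat hz)/entering_nil.
  by rewrite /ends_in hz nz /= onth_default // => /(_ erefl)[|[]].
move=> [n]; have [eb _] := bpre_split (BInf y) n.
rewrite /ends_in -eb bnth_iter_shift => -[|[]] //; exact: hy.
Qed.

End FromVertices.
End Invariant.

(** * Bisections and the Steinberg algebra *)

Section UnitEmbedding.
Variable E : graph.
Implicit Types (x z : bpath E) (a b : fpath E) (g : gpd E).

Lemma gpd_eq g g' : grng g = grng g' -> gdeg g = gdeg g' -> gsrc g = gsrc g' ->
  g = g'.
Proof.
case: g => x k y P; case: g' => x' k' y' P' /= ex ek ey; subst x' k' y'.
by rewrite (Prop_irrelevance P P').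
Qed.

Lemma gunitP x : exists (a b : fpath E) (x' : bpath E)
    (h : frng a = bsrc x') (h' : frng b = bsrc x'),
  [/\ x = bcat h, 0%R = ((flen a)%:Z - (flen b)%:Z)%R & x = bcat h'].
Proof.
have h : frng (fnil (bsrc x)) = bsrc x by [].
by exists (fnil (bsrc x)), (fnil (bsrc x)), x, h, h; rewrite bcatE subrr.
Qed.

(** Through this embedding, compact open sets of boundary paths become compact open bisections and
    so yield elements of the Steinberg algebra. *)
Definition gunit x : gpd E := Gpd (gunitP x).

Lemma gcyl_gunit a b x : gcyl a b (gunit x) <-> a = b /\ cyl a x.
Proof.
split=> [[z [ha [hb [/= xa ab xb]]]]|[<- [z [h xz]]]]; last first.
  by exists z, h, h; rewrite /= subrr.
have ax : cyl a x by exists z, ha.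
split=> //; apply: (fpath_cyl ax); [by exists z, hb|lia].
Qed.

Lemma gunit_grng a g : gcyl a a g -> g = gunit (grng g).
Proof.
move=> [z [ha [hb [er ed es]]]]; apply: gpd_eq => //=;
  first by rewrite ed subrr.
by rewrite es er (Prop_irrelevance ha hb).
Qed.

Lemma gpd_openE (A : set (gpd E)) :
  open A <-> exists2 D, D `<=` @gcyl_basis E & \bigcup_(B in D) B = A.
Proof. by []. Qed.

Lemma open_gunit (A : set (bpath E)) : open A -> open (gunit @` A).
Proof.
move=> /bpath_openE[D sD <-]; rewrite image_bigcup; apply: bigcup_open => B DB.
have [a [F [fF sF ->]]] := sD _ DB.
set W := (X in open X); apply/gpd_openE.
exists [set W]; last by rewrite bigcup_set1.
move=> _ ->; exists a, a, (@fedge E @` F); split=> //.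
- exact: finite_image.
- by move=> _ [e Fe <-] /=; exact: sF.
rewrite /W; apply/seteqP; split=> g.
  move=> [x [ax nx] <-]; split; first exact/gcyl_gunit.
  move=> [_ [e Fe <-] [h [h' /gcyl_gunit[_ hx]]]].
  by apply: nx; exists e => //; exists h.
move=> [ag ng]; have eg := gunit_grng ag; exists (grng g) => //.
move: ag; rewrite eg => /gcyl_gunit[_ ax]; split=> // -[e Fe [h hx]].
apply: ng; exists (fedge e); first by exists e.
by exists h, h; rewrite eg; apply/gcyl_gunit.
Qed.

(** $Z(a,b)$ pulls back to $Z(a)$ if $a=b$ and to the empty set otherwise; what a basic set removes
    pulls back to finitely many closed cylinders. *)
Lemma continuous_gunit : continuous gunit.
Proof.
apply/continuousP => A /gpd_openE[D sD <-]; rewrite preimage_bigcup.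
apply: bigcup_open => B DB; have [a [b [F [_ fF _ ->]]]] := sD _ DB.
have [<-|nab] := pselect (a = b); last first.
  suff -> : gunit @^-1` (gcyl a b `\` \bigcup_(c in F)
      [set g | exists (ha : frng a = fsrc c) (hb : frng b = fsrc c),
         gcyl (fcat ha) (fcat hb) g]) = set0 by exact: open0.
  by apply/seteqP; split=> // x [/gcyl_gunit[]].
set C := \bigcup_(c in F) _.
have -> : gunit @^-1` (gcyl a a `\` C) = cyl a `\` gunit @^-1` C.
  apply/seteqP; split=> x [h1 h2]; split=> //; last exact/gcyl_gunit.
  by have /gcyl_gunit[] := h1.
rewrite setDE; apply: openI; first exact: open_cyl.
apply: closed_openC; rewrite preimage_bigcup; apply: closed_bigcup => // c Fc.
have [h|nh] := pselect (frng a = fsrc c); last first.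
  suff -> : gunit @^-1` [set g | exists ha hb : frng a = fsrc c,
    gcyl (fcat ha) (fcat hb) g] = set0 by exact: closed0.
  by apply/seteqP; split=> // x [].
suff -> : gunit @^-1` [set g | exists ha hb : frng a = fsrc c,
    gcyl (fcat ha) (fcat hb) g] = cyl (fcat h) by exact: closed_cyl.
apply/seteqP; split=> x.
  by move=> [h1 [h2 /gcyl_gunit[_]]]; rewrite (Prop_irrelevance h h1).
by move=> hx; exists h, h; apply/gcyl_gunit.
Qed.

Lemma gunit_bisection (A : set (bpath E)) : open A -> open_bisection (gunit @`
  A).
Proof.
move=> oA; have oB := open_gunit oA.
have im (f : gpd E -> bpath E) : (forall x, f (gunit x) = x) ->
    homeo_on f (gunit @` A) /\ open (f @` (gunit @` A)).
  move=> fK; have eA : f @` (gunit @` A) = A.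
    apply/seteqP; split=> x; first by move=> [_ [z Az <-] <-]; rewrite fK.
    by move=> Ax; exists (gunit x); [exists x|exact: fK].
  split; last by rewrite eA.
  split.
  - move=> _ _ /set_mem[x _ <-] /set_mem[z _ <-]; rewrite !fK => ->//.
  - apply: continuous_in_subspaceT => _ /set_mem[x Ax <-] W; rewrite fK => nW.
    have [V [oV Vx] sV] : exists2 V, open_nbhs x V & V `<=` W by move: nW;
      rewrite nbhsE.
    apply: (@filterS _ _ _ (gunit @` (A `&` V))).
      by move=> _ [z [Az Vz] <-] /=; rewrite fK; exact: sV.
    apply: open_nbhs_nbhs; split; last by exists x.
    by apply: open_gunit; exact: openI.
  - move=> W oW; exists (gunit @^-1` W).
      by have /continuousP := continuous_gunit; apply.
    rewrite eA; apply/seteqP; split=> x.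
      by move=> [_ [[z Az <-] Wz] <-]; rewrite fK.
    by move=> [Ax Wx]; exists (gunit x) => //; split=> //; exists x.
by split=> //; apply: im.
Qed.

Lemma compact_gunit (A : set (bpath E)) : compact A -> compact (gunit @` A).
Proof.
move=> cA; apply: continuous_compact => //.
apply: continuous_subspaceT; exact: continuous_gunit.
Qed.

Lemma bisection_restrict (B : set (gpd E)) (U : set (bpath E)) :
  compact B -> open_bisection B -> clopen U ->
  compact (B `&` @gsrc E @^-1` U) /\ open_bisection (B `&` @gsrc E @^-1` U).
Proof.
move=> cB [oB [hr or] [hs os]] [oU clU].
have oBV V : open V -> open (B `&` @gsrc E @^-1` V).
  move=> oV; have [_ /continuousP/(_ V oV)/open_subspaceP[V' oV' e] _] := hs.
  by rewrite setIC -e; exact: openI.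
have oB' := oBV _ oU; set B' := B `&` _ in oB' *.
have sB : B' `<=` B by move=> g [].
split.
  (* Closedness of [U] makes the removed part open, so [B'] is closed in the compact set [B]. *)
  have -> : B' = B `&` ~` (B `&` @gsrc E @^-1` (~` U)).
    apply/seteqP; split=> g [Bg h]; split=> //; first by move=> [].
    by apply: contrapT => nU; apply: h.
  apply: compact_closedI => //; apply: open_closedC; apply: oBV.
  exact: closed_openC.
have im (f : gpd E -> bpath E) : homeo_on f B -> open (f @` B) ->
    homeo_on f B' /\ open (f @` B').
  move=> [fi fc fo] ofB.
  have op W : open W -> W `<=` B' -> open (f @` W).
    move=> oW sW; have [W' oW'] := fo _ oW.
    have -> : B `&` W = W by apply/seteqP; split=> [g []//|g Wg]; split=> //;
      exact/sB/sW.
    by move=> ->; exact: openI.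
  split; last exact: op.
  split.
  - by move=> g g' /set_mem hg /set_mem hg'; apply: fi; apply/mem_set;
    exact: sB.
  - exact: continuous_subspaceW sB fc.
  - move=> W oW; exists (f @` (B' `&` W)); first by apply: op;
    [exact: openI|move=> ? []].
    by apply/seteqP; split=> [x [g [h1 h2] <-]|x []//]; split; exists g.
by split=> //; apply: im.
Qed.

End UnitEmbedding.

(** * Direct sums of ideals of the Steinberg algebra *)

Section SteinbergSum.
Variables (K : fieldType) (E : graph).
Local Open Scope ring_scope.
Implicit Types (U V : set (bpath E)) (f : gpd E -> K^o).

Lemma steinberg_add f f' : steinberg K E f -> steinberg K E f' ->
  steinberg K E (f + f').
Proof.
move=> [n [c [b [hb ->]]]] [m [c' [b' [hb' ->]]]].
exists (n + m)%N, (fun i => match fintype.split i with inl j => c j | inr j =>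
  c' j end),
  (fun i => match fintype.split i with inl j => b j | inr j => b' j end).
split; first by move=> i; case: fintype.split.
rewrite big_split_ord; congr (_ + _); apply: eq_bigr => i _.
  by rewrite (unsplitK (inl i)).
by rewrite (unsplitK (inr i)).
Qed.

Lemma steinberg_restrict f U : steinberg K E f -> clopen U ->
  steinberg K E (fun g => f g * \1_(@gsrc E @^-1` U) g).
Proof.
move=> [n [c [b [hb ->]]]] clU;
  exists n, c, (fun i g => b i g * \1_(@gsrc E @^-1` U) g).
split.
  move=> i; have [B [cB oB] <-] := hb i.
  have [c1 o1] := bisection_restrict cB oB clU.
  exists (B `&` @gsrc E @^-1` U) => //.
  by rewrite indicI.
apply/funext => g; rewrite !fct_sumE mulr_suml; apply: eq_bigr => i _.
exact: esym (mulrA (c i) (b i g) _).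
Qed.

Lemma steinberg_direct_sum U : clopen U ->
  direct_sum (steinberg K E) (steinberg_ideal K U) (steinberg_ideal K (~` U)).
Proof.
move=> clU; have clV : clopen (~` U).
  by split; [exact: closed_openC clU.2|exact: open_closedC clU.1].
have supp f V : @gsrc E @` [set g | f g * \1_(@gsrc E @^-1` V) g != 0] `<=` V.
  move=> _ [g hg <-]; apply: contrapT => nV; move: hg => /=.
  by rewrite indicE memNset // mulr0 eqxx.
split; apply/seteqP; split=> f.
- move=> sf; exists (fun g => f g * \1_(@gsrc E @^-1` U) g).
    by split; [exact: steinberg_restrict|exact: supp].
  exists (fun g => f g * \1_(@gsrc E @^-1` (~` U)) g).
    by split; [exact: steinberg_restrict|exact: supp].
  apply/funext => g; rewrite [LHS]/GRing.add /= -mulrDr !indicE preimage_setC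
    in_setC.
  by case: (_ \in _); rewrite ?addr0 ?add0r mulr1.
- by move=> [f1 [s1 _] [f2 [s2 _] <-]]; exact: steinberg_add.
- move=> [[_ h1] [_ h2]]; apply/funext => g; apply: contrapT => /eqP ng.
  by apply: (h2 (gsrc g)); [exists g|apply: h1; exists g].
- move=> ->; have s0 : steinberg K E 0.
    by exists 0%N, (fun=> 0), (fun=> 0); split=> [[]|]; rewrite ?big_ord0.
  by split; split=> // x [g /=]; rewrite eqxx.
Qed.

(** A common point would have a compact open neighbourhood $Z(a\setminus F)$ in both sets, and the
    indicator of its units would be a nonzero element of both ideals. *)
Lemma steinberg_disjoint U V : open U -> open V ->
  steinberg_ideal K U `&` steinberg_ideal K V = [set 0] -> U `&` V = set0.
Proof.
move=> oU oV h; apply/seteqP; split=> // x [Ux Vx].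
have /nbhs_cylD[a [F [fF ax sF]]] : nbhs x (U `&` V).
  by apply: open_nbhs_nbhs; split; [exact: openI|].
pose A := cylD a F.
have cA : compact A.
  have -> : A = cyl a `&` \bigcap_(e in F) ~` cylE a e.
    apply/seteqP; split=> y [ay hy]; split=> // e Fe; first by move=> [_];
      exact: hy.
    by move=> he; apply: (hy e Fe).
  apply: compact_closedI; first exact: compact_cyl.
  apply: closed_bigI => e _; apply: open_closedC;
    apply: open_nbhsW => y [ay hy].
  have [b [_ _ _ eb]] := fsnocP (cyl_next ay hy).
  by rewrite -eb; apply: open_nbhs_nbhs; split; [exact: open_cyl|rewrite eb].
have oA : open A by exact: open_cylD.
pose f : gpd E -> K^o := \1_(@gunit E @` A).
have sf : steinberg K E f.
  exists 1%N, (fun=> 1), (fun=> f); split; last by rewrite big_ord1 scale1r.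
  move=> _; exists (@gunit E @` A) => //.
  by split; [exact: compact_gunit|exact: gunit_bisection].
have supp : @gsrc E @` [set g | f g != 0] `<=` U `&` V.
  move=> _ [g hg <-]; apply: sF;
    have [[y Ay <-] //|ng] := pselect ((@gunit E @` A) g).
  by move: hg; rewrite /= /f indicE memNset // eqxx.
have : (steinberg_ideal K U `&` steinberg_ideal K V) f.
  by split; split=> // y /supp[].
rewrite h => /(congr1 (fun u : gpd E -> K^o => u (gunit x))).
rewrite /f indicE mem_set; last by exists x.
by move=> /eqP; rewrite oner_eq0.
Qed.

End SteinbergSum.

Local Open Scope ring_scope.
Local Notation "x ** y" := (amul x y) (at level 40, left associativity).

(** * The representation of the Leavitt path algebra *)

Section AssocAlgebra.
Variables (K : fieldType) (A : assocAlgType K).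
Implicit Types x y z : A.

Lemma amul0 x : x ** 0 = 0.
Proof. by apply: (addrI (x ** 0)); rewrite -amulDr !addr0. Qed.

Lemma amul0l x : 0 ** x = 0.
Proof. by apply: (addrI (0 ** x)); rewrite -amulDl !addr0. Qed.

Lemma amulBl x y z : (x - y) ** z = x ** z - y ** z.
Proof. by rewrite -!scaleN1r amulDl scale_amull. Qed.

Lemma amul_suml I (r : seq I) (f : I -> A) x :
  (\sum_(i <- r) f i) ** x = \sum_(i <- r) f i ** x.
Proof. by elim/big_rec2: _ => [|i y z _ <-]; rewrite ?amul0l ?amulDl. Qed.

Lemma amul_sumr I (r : seq I) (f : I -> A) x :
  x ** (\sum_(i <- r) f i) = \sum_(i <- r) x ** f i.
Proof. by elim/big_rec2: _ => [|i y z _ <-]; rewrite ?amul0 ?amulDr. Qed.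

Lemma ideal_sub (I0 : set A) (a b : A) :
  ideal I0 -> I0 a -> I0 b -> I0 (a - b).
Proof.
by move=> [_ hD hZ _] ha hb; rewrite -scaleN1r; apply: hD => //; exact: hZ.
Qed.

Lemma ideal_mull (I0 : set A) (a b : A) : ideal I0 -> I0 b -> I0 (a ** b).
Proof. by move=> [_ _ _ h] /(h a)[]. Qed.

Lemma ideal_mulr (I0 : set A) (a b : A) : ideal I0 -> I0 a -> I0 (a ** b).
Proof. by move=> [_ _ _ h] /(h b)[]. Qed.

Lemma ideal_sum (I : set A) T (r : seq T) (h : T -> A) :
  ideal I -> (forall i, I (h i)) -> I (\sum_(i <- r) h i).
Proof. by move=> [I0 ID _ _] hI; elim/big_ind: _. Qed.

End AssocAlgebra.

Lemma bnth0_none (E : graph) (x : bpath E) : bnth x 0 = None ->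
  sink (bsrc x) \/ inf_emitter (bsrc x).
Proof. by case: x => [[v [|e s] w] h|y]. Qed.

Lemma size_bedges_some (E : graph) (x : bpath E) (j : nat) e :
  bnth x j = Some e -> size (bedges x j.+1) = j.+1.
Proof.
elim: j x => [|j IH] x h; first by rewrite /= h.
have [e0 h0] : exists e0, bnth x 0 = Some e0.
  case h0: (bnth x 0) => [e0|]; first by exists e0.
  by move: h; rewrite -[j.+1]addn0 -bnth_iter_shift (iter_shift_nil _ h0) h0.
by rewrite [bedges _ _]/= h0 /= -/(bedges _ j.+1) IH // bnth_shift.
Qed.

Section Representation.
Variables (K : fieldType) (E : graph).
Local Notation F := (bpath E * int -> K^o).
Local Notation L := (leavitt K E).
Implicit Types (v w : vert E) (e : edge E) (s t : seq (edge E)).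
Implicit Types (x z : bpath E) (f g : F) (a b : L).

Definition gV v : L := pclass (@lpa_rel K E) (AGen (LVert v)).
Definition gE e : L := pclass (@lpa_rel K E) (AGen (LEdge e)).
Definition gG e : L := pclass (@lpa_rel K E) (AGen (LGhost e)).

Definition opV v f : F := fun p => if bsrc p.1 == v then f p else 0.
(** On point masses, [opE e] prepends [e] and raises the degree by 1, and [opG e] undoes this; see
    [opE_dlt] and [opG_dlt]. The pointwise formulas define the action on all functions, without
    finiteness conditions. *)
Definition opE e f : F :=
  fun p => if bnth p.1 0 == Some e then f (bshift p.1, p.2 - 1) else 0.
Definition opG e f : F :=
  fun p => if rng e == bsrc p.1 then f (bcons e p.1, p.2 + 1) else 0.

Fixpoint arho (u : aterm K (lpa_gen E)) (f : F) : F :=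
  match u with
  | AGen (LVert v) => opV v f
  | AGen (LEdge e) => opE e f
  | AGen (LGhost e) => opG e f
  | AZero => 0
  | AAdd u1 u2 => arho u1 f + arho u2 f
  | AScale k u1 => k *: arho u1 f
  | AMul u1 u2 => arho u1 (arho u2 f)
  end.

Lemma arho_linear u k f g : arho u (k *: f + g) = k *: arho u f + arho u g.
Proof.
elim: u k f g => [[v|e|e]||u1 IH1 u2 IH2|c u1 IH1|u1 IH1 u2 IH2] k f g /=.
- by apply/funext => p; rewrite /opV !fctE; case: ifP; rewrite ?scaler0 ?addr0.
- by apply/funext => p; rewrite /opE !fctE; case: ifP; rewrite ?scaler0 ?addr0.
- by apply/funext => p; rewrite /opG !fctE; case: ifP; rewrite ?scaler0 ?addr0.
- by rewrite scaler0 addr0.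
- by rewrite IH1 IH2 scalerDr addrACA.
- by rewrite IH1 scalerDr !scalerA mulrC.
- by rewrite IH2 IH1.
Qed.

Lemma arho_rel u1 u2 f : lpa_rel u1 u2 -> arho u1 f = arho u2 f.
Proof.
case=> [v|v w vw|e|e|e|e|e|e e' ee|v n h reg inj rh] /=; apply/funext => -[x m];
    rewrite /opV /opE /opG /=.
- by case: (bsrc x == v).
- by case: eqP => // ->; rewrite (introF eqP vw).
- by case: (bnth x 0 =P Some e) => [/bnth0_src ->|]; rewrite ?eqxx //;
  case: ifP.
- by case: eqP => // /bsrc_shift ->; rewrite eqxx.
- by rewrite eq_sym; case: (rng e == bsrc x).
- by case: eqP => // h; rewrite bsrc_bcons // eqxx.
- rewrite eq_sym; case: eqP => // h; rewrite bnth_bcons0 // eqxx bshift_cons //.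
  by rewrite addrK.
- case: eqP => // h; rewrite bnth_bcons0 //; case: eqP => // -[].
  by move=> /ee.
have -> : arho (\big[@AAdd K (lpa_gen E)/AZero]_(i < n)
    AMul (AGen (LEdge (h i))) (AGen (LGhost (h i)))) f =
    \sum_(i < n) opE (h i) (opG (h i) f).
  by elim/big_rec2: _ => //= i u u' _ <-.
have term i : opE (h i) (opG (h i) f) (x, m) =
    if bnth x 0 == Some (h i) then f (x, m) else 0.
  rewrite /opE /opG /=; case: eqP => // hx.
  by rewrite (bsrc_shift hx) eqxx bcons_shift // subrK.
rewrite fct_sumE (eq_bigr _ (fun i _ => term i)).
case: (bsrc x =P v) => [sx|nsx]; last first.
  rewrite big1 // => i _; case: eqP => // /bnth0_src hi; case: nsx.
  rewrite -hi; have : range h (h i) by exists i.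
  by rewrite rh.
(* A boundary path cannot stop at a regular vertex, so exactly one summand survives. *)
have [e he] : exists e, bnth x 0 = Some e.
  case hx: (bnth x 0) => [e|]; first by exists e.
  by have := bnth0_none hx; rewrite sx; case: reg; tauto.
have [i _ hi] : range h e by rewrite rh /=; rewrite (bnth0_src he).
rewrite (bigD1 i) //= he hi eqxx big1 ?addr0 // => j ji.
case: eqP => // -[]; rewrite -hi => /inj ij.
by rewrite ij eqxx in ji.
Qed.

Lemma arho_cong u1 u2 f : acong (@lpa_rel K E) u1 u2 -> arho u1 f = arho u2 f.
Proof.
move=> h; elim: h f => {u1 u2}.
- by move=> u1 u2 /arho_rel.
- by [].
- by move=> u1 u2 _ IH f; rewrite IH.
- by move=> u1 u2 u3 _ IH1 _ IH2 f; rewrite IH1.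
- by move=> u1 u1' u2 u2' _ IH1 _ IH2 f /=; rewrite IH1 IH2.
- by move=> k u1 u1' _ IH1 f /=; rewrite IH1.
- by move=> u1 u1' u2 u2' _ IH1 _ IH2 f /=; rewrite IH2 IH1.
- by move=> u1 u2 u3 f /=; rewrite addrA.
- by move=> u1 u2 f /=; rewrite addrC.
- by move=> u f /=; rewrite add0r.
- by move=> u f /=; rewrite scaleN1r addNr.
- by move=> k k' u f /=; rewrite scalerA.
- by move=> u f /=; rewrite scale1r.
- by move=> k u1 u2 f /=; rewrite scalerDr.
- by move=> k k' u f /=; rewrite scalerDl.
- by [].
- by [].
- move=> u1 u2 u3 f /=; have := arho_linear u1 1 (arho u2 f) (arho u3 f).
  by rewrite !scale1r.
- by [].
- move=> k u1 u2 f /=; have := arho_linear u1 k (arho u2 f) 0.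
  have := arho_linear u1 (-1) 0 0; rewrite scaler0 addr0 scaleN1r addNr => ->.
  by rewrite !addr0.
Qed.

(** Without the integer that records degrees, a cycle without exits would act
    as its base vertex, and the action would not be faithful. *)
Definition rho a f : F := arho (repr a) f.

Lemma rho_pclass u f : rho (pclass (@lpa_rel K E) u) f = arho u f.
Proof. exact/arho_cong/pclass_repr_cong. Qed.

Lemma pclass_surj a : exists u, a = pclass (@lpa_rel K E) u.
Proof. by exists (repr a); rewrite pclass_repr. Qed.

Lemma rhoD a b f : rho (a + b) f = rho a f + rho b f.
Proof.
have [u ->] := pclass_surj a; have [u' ->] := pclass_surj b.
by rewrite [X in rho X _](pclassD (@lpa_rel K E) u u') !rho_pclass.
Qed.

Lemma rhoZ k a f : rho (k *: a) f = k *: rho a f.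
Proof.
have [u ->] := pclass_surj a.
by rewrite [X in rho X _](pclassZ (@lpa_rel K E) k u) !rho_pclass.
Qed.

Lemma rhoM a b f : rho (a ** b) f = rho a (rho b f).
Proof.
have [u ->] := pclass_surj a; have [u' ->] := pclass_surj b.
by rewrite [X in rho X _](pclassM (@lpa_rel K E) u u') !rho_pclass.
Qed.

Lemma rho_linear a k f g : rho a (k *: f + g) = k *: rho a f + rho a g.
Proof. exact: arho_linear. Qed.

Lemma rho0l f : rho 0 f = 0.
Proof. by rewrite -(scale0r (0 : L)) rhoZ scale0r. Qed.

Lemma rho0 a : rho a 0 = 0.
Proof.
by have := rho_linear a (-1) 0 0; rewrite scaler0 addr0 scaleN1r addNr.
Qed.

Lemma rhoB a b f : rho (a - b) f = rho a f - rho b f.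
Proof. by rewrite -scaleN1r rhoD rhoZ scaleN1r. Qed.

Lemma rho_suml I (r : seq I) (h : I -> L) f :
  rho (\sum_(i <- r) h i) f = \sum_(i <- r) rho (h i) f.
Proof. by elim/big_rec2: _ => [|i y z _ <-]; rewrite ?rho0l ?rhoD. Qed.

Lemma rhoV v f : rho (gV v) f = opV v f.
Proof. exact: rho_pclass. Qed.

Lemma rhoE e f : rho (gE e) f = opE e f.
Proof. exact: rho_pclass. Qed.

Lemma rhoG e f : rho (gG e) f = opG e f.
Proof. exact: rho_pclass. Qed.

Lemma lpaP u u' : lpa_rel u u' ->
  pclass (@lpa_rel K E) u = pclass (@lpa_rel K E) u'.
Proof. by move=> h; apply/pclassP; apply: ac_rel. Qed.

Lemma lpaM u u' : (pclass (@lpa_rel K E) u : L) ** pclass (@lpa_rel K E) u' =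
  pclass (@lpa_rel K E) (AMul u u').
Proof. exact: pclassM. Qed.

Lemma VV v w : gV v ** gV w = if v == w then gV v else 0.
Proof.
rewrite lpaM; case: eqP => [<-|h]; first exact: lpaP (lpa_vv _ _).
exact: (lpaP (lpa_vw K h)).
Qed.

Lemma VE v e : gV v ** gE e = if v == src e then gE e else 0.
Proof.
have h : gV (src e) ** gE e = gE e by rewrite lpaM; exact: lpaP (lpa_se _ _).
by rewrite -{1}h amulA VV; case: eqP => [->|]; rewrite ?amul0l.
Qed.

Lemma EV e v : gE e ** gV v = if rng e == v then gE e else 0.
Proof.
have h : gE e ** gV (rng e) = gE e by rewrite lpaM; exact: lpaP (lpa_er _ _).
by rewrite -{1}h -amulA VV; case: eqP; rewrite ?amul0.
Qed.

Lemma VG v e : gV v ** gG e = if v == rng e then gG e else 0.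
Proof.
have h : gV (rng e) ** gG e = gG e by rewrite lpaM; exact: lpaP (lpa_rg _ _).
by rewrite -{1}h amulA VV; case: eqP => [->|]; rewrite ?amul0l.
Qed.

Lemma GV e v : gG e ** gV v = if src e == v then gG e else 0.
Proof.
have h : gG e ** gV (src e) = gG e by rewrite lpaM; exact: lpaP (lpa_gs _ _).
by rewrite -{1}h -amulA VV; case: eqP; rewrite ?amul0.
Qed.

Lemma GE e e' : gG e ** gE e' = if e == e' then gV (rng e) else 0.
Proof.
rewrite lpaM; case: eqP => [<-|h]; first exact: lpaP (lpa_ck1 _ _).
exact: (lpaP (lpa_ck1_neq K h)).
Qed.

Lemma CK2 v : regular v -> exists r : seq (edge E),
  gV v = \sum_(e <- r) gE e ** gG e.
Proof.
move=> reg; have fin : finite_set (src @^-1` [set v] : set (edge E)).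
  by apply: contrapT; case: reg.
have [r ur er] : exists2 r : seq (edge E), uniq r & [set` r] = src @^-1` [set
  v].
  move/finite_seqP: fin => [r er]; exists (undup r); first exact: undup_uniq.
  by rewrite er; apply/seteqP; split=> e /=; rewrite mem_undup.
exists r; pose h (i : 'I_(size r)) := tnth (in_tuple r) i.
have inj : injective h by move=> i j /(tuple_uniqP (in_tuple r) ur).
have rh : range h = src @^-1` [set v].
  rewrite -er; apply/seteqP; split=> e /=.
    by move=> [i _ <-]; exact: mem_tnth.
  by move=> /(tnthP (in_tuple r))[i ->]; exists i.
rewrite [LHS](lpaP (lpa_ck2 K reg inj rh)) (big_tnth _ _ r).
elim/big_rec2: _ => // i u u' _ <-.
rewrite lpaM; apply/esym; exact: pclassD.
Qed.

(** The monomials [s t^*]; they vanish unless [s] and [t] are paths to [w]. *)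
Definition mE s w : L := foldr (fun e a => gE e ** a) (gV w) s.
Definition mG t w : L := foldr (fun e a => a ** gG e) (gV w) t.
Definition mon s t w : L := mE s w ** mG t w.

Lemma V_mE v s w : gV v ** mE s w = if v == hd s w then mE s w else 0.
Proof.
case: s => [|e s] /=; last by rewrite amulA VE; case: ifP; rewrite ?amul0l.
by rewrite VV; case: eqP => [->|].
Qed.

Lemma mG_V v t w : mG t w ** gV v = if hd t w == v then mG t w else 0.
Proof.
case: t => [|e t] /=; last by rewrite -amulA GV; case: ifP; rewrite ?amul0.
by rewrite VV.
Qed.

Lemma mE_V s w v : mE s w ** gV v = if w == v then mE s w else 0.
Proof.
elim: s => [|e s IH] /=; first exact: VV.
by rewrite -amulA IH; case: ifP; rewrite ?amul0.
Qed.

Lemma mon_nil s w : mon s [::] w = mE s w.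
Proof. by rewrite /mon mE_V eqxx. Qed.

Lemma mE_rcons s e : mE (rcons s e) (rng e) = mE s (src e) ** gE e.
Proof.
elim: s => [|e' s IH] /=; first by rewrite EV VE !eqxx.
by rewrite IH amulA.
Qed.

Lemma mG_rcons t e : mG (rcons t e) (rng e) = gG e ** mG t (src e).
Proof.
elim: t => [|e' t IH] /=; first by rewrite VG GV !eqxx.
by rewrite IH amulA.
Qed.

Lemma mE_ncomp s w : ~ comp s w -> mE s w = 0.
Proof.
elim: s => //= e s IH /not_andP[|/IH ->]; last by rewrite amul0.
move=> /eqP/negbTE h; have := V_mE (rng e) s w; rewrite h => h'.
have := EV e (rng e); rewrite eqxx => <-.
by rewrite -amulA h' amul0.
Qed.

(** [P] restricts only the ghost part [t], whose length drives the induction for faithfulness. *)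
Inductive spn (P : seq (edge E) -> Prop) : L -> Prop :=
| spn0 : spn P 0
| spnS k s t w a : P t -> spn P a -> spn P (k *: mon s t w + a).

Lemma spn_mon (P : seq (edge E) -> Prop) s t w : P t -> spn P (mon s t w).
Proof.
move=> h; rewrite -[mon s t w]addr0 -[mon s t w]scale1r; apply: spnS => //.
exact: spn0.
Qed.

Lemma spnD (P : seq (edge E) -> Prop) a b : spn P a -> spn P b -> spn P (a + b).
Proof.
move=> ha hb; elim: ha => [|k s t w c ht _ IH]; first by rewrite add0r.
by rewrite -addrA; apply: spnS.
Qed.

Lemma spnZ (P : seq (edge E) -> Prop) k a : spn P a -> spn P (k *: a).
Proof.
elim=> [|k' s t w c ht _ IH]; first by rewrite scaler0; exact: spn0.
by rewrite scalerDr scalerA; apply: spnS.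
Qed.

Lemma spn_sub (P Q : seq (edge E) -> Prop) a : (forall t, P t -> Q t) ->
  spn P a -> spn Q a.
Proof.
by move=> h; elim=> [|k s t w c ht _ IH]; [exact: spn0|apply: spnS => //;
  exact: h].
Qed.

Lemma spn_mull (P : seq (edge E) -> Prop) a c :
  (forall s t w, P t -> spn P (c ** mon s t w)) -> spn P a -> spn P (c ** a).
Proof.
move=> h; elim=> [|k s t w b ht _ IH]; first by rewrite amul0; exact: spn0.
by rewrite amulDr -scale_amulr; apply: spnD => //; apply: spnZ; exact: h.
Qed.

Lemma spn_mulr (P Q : seq (edge E) -> Prop) a c :
  (forall s t w, P t -> spn Q (mon s t w ** c)) -> spn P a -> spn Q (a ** c).
Proof.
move=> h; elim=> [|k s t w b ht _ IH]; first by rewrite amul0l; exact: spn0.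
by rewrite amulDl -scale_amull; apply: spnD => //; apply: spnZ; exact: h.
Qed.

Local Notation full := (fun=> True).

Lemma spn_gen (u : lpa_gen E) s t w :
  spn full ((pclass (@lpa_rel K E) (AGen u) : L) ** mon s t w).
Proof.
case: u => [v|e|e].
- rewrite -/(gV v) /mon amulA V_mE; case: ifP => _; first exact: spn_mon.
  by rewrite amul0l; exact: spn0.
- rewrite -/(gE e) /mon amulA; exact: (@spn_mon _ (e :: s)).
- rewrite -/(gG e) /mon amulA; case: s => [|e' s] /=.
    rewrite GV; case: eqP => [<-|_]; last by rewrite amul0l; exact: spn0.
    have := @spn_mon full [::] (rcons t e) (rng e) I.
    by rewrite /mon /= mG_rcons amulA VG eqxx.
  rewrite amulA GE; case: eqP => [_|_]; last by rewrite !amul0l; exact: spn0.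
  rewrite V_mE; case: eqP => [_|_]; last by rewrite amul0l; exact: spn0.
  exact: spn_mon.
Qed.

Lemma spn_full a : spn full a.
Proof.
have [u ->] := pclass_surj a.
(* Without a unit, membership does not follow from stability under left multiplication, so both are
   proved together. *)
suff : (forall b, spn full b -> spn full ((pclass (@lpa_rel K E) u : L) ** b))
  /\
   spn full (pclass (@lpa_rel K E) u) by case.
elim: u {a} => [g||u1 [m1 s1] u2 [m2 s2]|k u1 [m1 s1]|u1 [m1 s1] u2 [m2 s2]].
- split; first by move=> b; apply: spn_mull => s t w _; exact: spn_gen.
  case: g => [v|e|e].
  + by have := @spn_mon full [::] [::] v I; rewrite mon_nil.
  + have := @spn_mon full [:: e] [::] (rng e) I.
    by rewrite mon_nil /= EV eqxx.
  + have := @spn_mon full [::] [:: e] (rng e) I.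
    by rewrite /mon /= VG eqxx VG eqxx.
- by split=> [b _|]; [rewrite [X in spn _ X](amul0l b)|]; exact: spn0.
- rewrite -[pclass _ _]/((pclass (@lpa_rel K E) (AAdd u1 u2)) : L).
  rewrite -(pclassD (@lpa_rel K E) u1 u2); split; last exact: spnD.
  by move=> b hb; rewrite [X in spn _ X]amulDl; apply: spnD; auto.
- rewrite -(pclassZ (@lpa_rel K E) k u1); split; last exact: spnZ.
  by move=> b hb; rewrite -[X in spn _ X]scale_amull; apply: spnZ; auto.
- rewrite -(pclassM (@lpa_rel K E) u1 u2); split; last exact: m1.
  by move=> b hb; rewrite -[X in spn _ X]amulA; apply: m1; exact: m2.
Qed.

Implicit Types (y : bpath E) (m n : int) (U W : set (bpath E)).

Lemma mon_V s t w v : mon s t w ** gV v = if hd t w == v then mon s t w else 0.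
Proof. by rewrite /mon -amulA mG_V; case: ifP; rewrite ?amul0. Qed.

(** A monomial is fixed on the right by its vertex [hd t w] and annihilated by all others. The inner
    claim admits every duplicate-free list containing [vs0], so that summands can share one list. *)
Lemma local_unit a : exists vs : seq (vert E), a = \sum_(v <- vs) a ** gV v.
Proof.
have [vs0 h] : exists vs0 : seq (vert E), forall vs, uniq vs ->
    {subset vs0 <= vs} -> a = \sum_(v <- vs) a ** gV v.
  elim: (spn_full a) => [|k s t w b _ _ [vs0 IH]].
    by exists [::] => vs _ _; rewrite big1 // => v _; rewrite amul0l.
  exists (hd t w :: vs0) => vs uvs sub.
  rewrite (eq_bigr (fun v => (k *: mon s t w) ** gV v + b ** gV v)); last first.
    by move=> v _; rewrite amulDl.
  rewrite big_split /= -IH //; last first.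
    by move=> v hv; apply: sub; rewrite in_cons hv orbT.
  congr (_ + _); rewrite (bigD1_seq (hd t w)) //=; last first.
    by apply: sub; rewrite in_cons eqxx.
  rewrite -scale_amull mon_V eqxx big1 ?addr0 // => v nv.
  by rewrite -scale_amull mon_V eq_sym (negbTE nv) scaler0.
exists (undup vs0); apply: h; first exact: undup_uniq.
by move=> v; rewrite mem_undup.
Qed.

Lemma rho_mE1 s w f z n : comp s w -> bsrc z = w ->
  rho (mE s w) f (ucat s z, n) = f (z, n - (size s)%:Z).
Proof.
move=> + hz; elim: s n => [|e s IH] n /=;
  first by rewrite rhoV /opV hz eqxx subr0.
move=> [h1 h2]; rewrite rhoM rhoE /opE /=.
have hs : rng e = bsrc (ucat s z) by rewrite bsrc_ucat hz.
rewrite bnth_bcons0 // eqxx bshift_cons // IH //; congr (f (_, _)); lia.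
Qed.

Lemma rho_mE0 s w f y n :
  (forall z, comp s w -> bsrc z = w -> y <> ucat s z) ->
  rho (mE s w) f (y, n) = 0.
Proof.
elim: s y n => [|e s IH] y n /= h.
  by rewrite rhoV /opV /=; case: eqP => // hy; case: (h y).
rewrite rhoM rhoE /opE /=; case: eqP => // hy.
apply: IH => z cz hz ey; apply: (h z) => //; last by rewrite -ey bcons_shift.
by split=> //; rewrite -(bsrc_shift hy) ey bsrc_ucat hz.
Qed.

Lemma rho_mG1 t w f z n : comp t w -> bsrc z = w ->
  rho (mG t w) f (z, n) = f (ucat t z, n + (size t)%:Z).
Proof.
move=> + hz; elim: t f => [|e t IH] f /=;
  first by rewrite rhoV /opV hz eqxx addr0.
move=> [h1 h2]; rewrite rhoM IH // rhoG /opG /=.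
have hs : rng e = bsrc (ucat t z) by rewrite bsrc_ucat hz.
rewrite hs eqxx; congr (f (_, _)); lia.
Qed.

Lemma rho_mG0 t w f z n : ~ (comp t w /\ bsrc z = w) ->
  rho (mG t w) f (z, n) = 0.
Proof.
elim: t f => [|e t IH] f /= h.
  by rewrite rhoV /opV /=; case: eqP => // hz; case: h.
rewrite rhoM; have [[ct hz]|nh] := pselect (comp t w /\ bsrc z = w);
  last exact: IH.
rewrite rho_mG1 // rhoG /opG /=; case: eqP => // he.
by case: h; split=> //; split=> //; rewrite he bsrc_ucat hz.
Qed.

Definition dlt x n : F := fun p => (p == (x, n))%:R.

Lemma dltE x n y m : dlt x n (y, m) = ((y == x) && (m == n))%:R.
Proof. by []. Qed.

Lemma opV_dlt v x n : rho (gV v) (dlt x n) = if bsrc x == v then dlt x n else 0.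
Proof.
rewrite rhoV; apply/funext => -[y m]; rewrite /opV /=.
case: (y =P x) => [->|/eqP h]; first by case: ifP.
by case: ifP => _; case: ifP => _ //; rewrite dltE (negbTE h).
Qed.

Lemma opE_dlt e x n : rho (gE e) (dlt x n) =
  if rng e == bsrc x then dlt (bcons e x) (n + 1) else 0.
Proof.
rewrite rhoE; apply/funext => -[y m]; rewrite /opE /=.
case: (bnth y 0 =P Some e) => hy.
  rewrite dltE; case: (rng e =P bsrc x) => he.
    rewrite dltE -{2}(bcons_shift hy); congr ((nat_of_bool (_ && _))%:R);
      last by lia.
    apply/eqP/eqP => [->//|]; apply: bcons_inj => //.
    by rewrite (bsrc_shift hy).
  by case: eqP => //= hs; case: he; rewrite -hs (bsrc_shift hy).
case: (rng e =P bsrc x) => // he; rewrite dltE; case: eqP => //= ey; case: hy.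
by rewrite ey bnth_bcons0.
Qed.

Lemma opG_dlt e x n : rho (gG e) (dlt x n) =
  if bnth x 0 == Some e then dlt (bshift x) (n - 1) else 0.
Proof.
rewrite rhoG; apply/funext => -[y m]; rewrite /opG /=.
case: (rng e =P bsrc y) => hy.
  rewrite dltE; case: (bnth x 0 =P Some e) => he.
    rewrite dltE; congr ((nat_of_bool (_ && _))%:R); last by lia.
    apply/eqP/eqP => [<-|->]; first by rewrite bshift_cons.
    exact: bcons_shift.
  by case: eqP => //= ex; case: he; rewrite -ex bnth_bcons0.
case: (bnth x 0 =P Some e) => // he; rewrite dltE; case: eqP => //= ey;
  case: hy.
by rewrite ey (bsrc_shift he).
Qed.

Lemma mon_dlt s t w z n : comp s w -> comp t w -> bsrc z = w ->
  rho (mon s t w) (dlt (ucat t z) n) = dlt (ucat s z) (n - (size t)%:Z + (size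
    s)%:Z).
Proof.
move=> cs ct hz; apply/funext => -[y m]; rewrite rhoM.
have [[z' [hz' ->]]|h] := pselect (exists z', bsrc z' = w /\ y = ucat s z').
  rewrite rho_mE1 // rho_mG1 // !dltE; congr ((nat_of_bool (_ && _))%:R);
    last by lia.
  apply/eqP/eqP; last by move=> /ucat_inj ->; rewrite ?hz ?hz'.
  by move=> /ucat_inj ->; rewrite ?hz ?hz'.
rewrite rho_mE0; last by move=> z' _ hz' ey; apply: h; exists z'.
rewrite dltE; case: eqP => //= ey; case: h; by exists z.
Qed.

Lemma mon_dlt0 s t w x n :
  (forall z, comp s w -> comp t w -> bsrc z = w -> x <> ucat t z) ->
  rho (mon s t w) (dlt x n) = 0.
Proof.
move=> h; apply/funext => -[y m]; rewrite rhoM.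
have [[cs [z' [hz' ->]]]|h'] := pselect (comp s w /\ exists z', bsrc z' = w /\
  y = ucat s z').
  rewrite rho_mE1 //; have [ct|nct] := pselect (comp t w); last first.
    by apply: rho_mG0 => -[].
  rewrite rho_mG1 // dltE; case: eqP => // ex; case: (h z') => //.
by apply: rho_mE0 => z cs hz ey; apply: h'; split=> //; exists z.
Qed.

Lemma mon_dltP s t w x n :
  rho (mon s t w) (dlt x n) = 0 \/
  exists z, [/\ comp s w, comp t w, bsrc z = w, x = ucat t z &
    rho (mon s t w) (dlt x n) = dlt (ucat s z) (n - (size t)%:Z + (size s)%:Z)].
Proof.
have [[z [cs ct hz ex]]|h] := pselect (exists z, [/\ comp s w, comp t w, bsrc z
  = w & x = ucat t z]).
  by right; exists z; split=> //; rewrite ex mon_dlt.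
left; apply: mon_dlt0 => z cs ct hz ex; apply: h; by exists z.
Qed.

(** * Faithfulness of the action *)

Definition kills a := forall x n, rho a (dlt x n) = 0.

Lemma kills_mul a b :
  (forall x n, rho b (dlt x n) = 0 \/ exists y m, rho b (dlt x n) = dlt y m) ->
  kills a -> kills (a ** b).
Proof.
move=> h ka x n; rewrite rhoM; have [->|[y [m ->]]] := h x n; last exact: ka.
exact: rho0.
Qed.

Lemma kills_V a v : kills a -> kills (a ** gV v).
Proof.
apply: kills_mul => x n; rewrite opV_dlt; case: ifP; [right|by left].
by exists x, n.
Qed.

Lemma kills_E a e : kills a -> kills (a ** gE e).
Proof.
apply: kills_mul => x n; rewrite opE_dlt; case: ifP; [right|by left].
by exists (bcons e x), (n + 1).
Qed.

Lemma ucat_eq_list s t z : comp s (bsrc z) -> comp t (bsrc z) ->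
  size s = size t -> ucat s z = ucat t z -> s = t.
Proof.
move=> cs ct st h.
have e : t = s ++ drop (size s) t.
  apply: onth_prefix => [|i hi]; first by rewrite st.
  have := congr1 (fun x => bnth x i) h.
  by rewrite !bnth_ucat // -st hi.
by rewrite e drop_oversize ?cats0 // st.
Qed.

(** A single test path suffices: among paths $s$ ending at $v$, the degree gives $|s|$, and then
    $sz$ determines $s$. Thus distinct paths send the point mass at $z$ to distinct point masses. *)
Lemma pure_faithful b v z : spn (fun t => t = [::]) b -> bsrc z = v ->
  rho b (dlt z 0) = 0 -> b ** gV v = 0.
Proof.
move=> sb hz kb.
have [l [cl el]] : exists l : seq (K * seq (edge E)),
    (forall p, p \in l -> comp p.2 v) /\ b ** gV v = \sum_(p <- l) p.1 *: mE
      p.2 v.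
  elim: sb {kb} => [|k s t w c -> _ [l [cl el]]].
    by exists [::]; split=> //; rewrite big_nil amul0l.
  rewrite amulDl el -scale_amull mon_nil mE_V.
  have [ew|wv] := eqVneq w v; last by exists l; rewrite scaler0 add0r.
  subst w.
  have [cs|ncs] := pselect (comp s v); last first.
    by exists l; rewrite mE_ncomp // scaler0 add0r.
  exists ((k, s) :: l); rewrite big_cons; split=> // p; rewrite in_cons.
  by move=> /orP[/eqP -> //|]; exact: cl.
have coef s : comp s v -> \sum_(p <- l) p.1 * (s == p.2)%:R = 0.
  move=> cs; have : rho (b ** gV v) (dlt z 0) = 0.
    by rewrite rhoM opV_dlt hz eqxx.
  move=> /(congr1 (fun f : F => f (ucat s z, (size s)%:Z))).
  rewrite el rho_suml fct_sumE => h; rewrite -[RHS]h.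
  apply: eq_big_seq => p hp; rewrite rhoZ [RHS]/(p.1 * _); congr (_ * _).
  have cp := cl p hp; rewrite -(mon_nil p.2 v).
  rewrite -[z in dlt z 0]/(ucat [::] z) mon_dlt //= dltE;
    congr ((nat_of_bool _)%:R).
  apply/eqP/andP => [<-|[/eqP h1 /eqP h2]]; first by split=> //; apply/eqP;
    rewrite /=; lia.
  by apply: (@ucat_eq_list _ _ z); rewrite ?hz //; lia.
(* A path may occur several times in [l]; [coef] kills only its total coefficient, so the sum is
   regrouped by paths. *)
rewrite el; pose S := undup (map snd l).
rewrite (eq_big_seq (fun p => \sum_(s <- S) (p.1 * (s == p.2)%:R) *: mE s v));
  last first.
  move=> p hp; rewrite (bigD1_seq p.2) ?undup_uniq ?mem_undup ?map_f //=.
  rewrite eqxx mulr1 big1 ?addr0 // => s /negbTE ->.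
  by rewrite mulr0 scale0r.
rewrite exchange_big /= big1_seq // => s /andP[_ hs].
have cs : comp s v.
  by move: hs; rewrite mem_undup => /mapP[p hp ->]; exact: cl.
by rewrite -scaler_suml coef // scale0r.
Qed.

Lemma spn_V (P : seq (edge E) -> Prop) a v : spn P a -> spn P (a ** gV v).
Proof.
apply: spn_mulr => s t w ht; rewrite mon_V; case: ifP => _;
  first exact: spn_mon.
exact: spn0.
Qed.

(** A nonempty ghost part loses its last factor against [e], or the product vanishes; with an empty
    one, [e] is absorbed into [s]. *)
Lemma spn_E k a e : spn (fun t => (size t <= k.+1)%N) a ->
  spn (fun t => (size t <= k)%N) (a ** gE e).
Proof.
apply: spn_mulr => s [|e' t] w ht.
  rewrite mon_nil; have [<-|nw] := eqVneq (src e) w.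
    by rewrite -mE_rcons -mon_nil; apply: spn_mon.
  have : mE s w ** gV w = mE s w by rewrite mE_V eqxx.
  move=> <-; rewrite -amulA VE eq_sym (negbTE nw) amul0; exact: spn0.
rewrite /mon -amulA /= -(amulA (mG t w)) GE; case: eqP => [_|_]; last first.
  by rewrite !amul0; exact: spn0.
by rewrite amulA -/(mon s t w); apply: spn_V; apply: spn_mon.
Qed.

(** [q] collects the monomials with a ghost factor: each ends in some $e^*$ and is fixed by $ee^*$
    on the right. As in [local_unit], the claim is proved for all larger lists. *)
Lemma ghost_decomp a : exists p q (es : seq (edge E)),
  [/\ a = p + q, spn (fun t => t = [::]) p &
      q = \sum_(e <- es) q ** gE e ** gG e].
Proof.
suff [p [q [es0 [ea sp h]]]] : exists p q (es0 : seq (edge E)),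
    [/\ a = p + q, spn (fun t => t = [::]) p & forall es, uniq es ->
      {subset es0 <= es} -> q = \sum_(e <- es) q ** gE e ** gG e].
  exists p, q, (undup es0); split=> //; apply: h; first exact: undup_uniq.
  by move=> e; rewrite mem_undup.
elim: (spn_full a) => [|k s t w b _ _ [p [q [es0 [-> sp IH]]]]].
  exists 0, 0, [::]; split; [by rewrite addr0|exact: spn0|move=> es _ _].
  by rewrite big1 // => e _; rewrite !amul0l.
case: t => [|e0 t].
  exists (k *: mon s [::] w + p), q, es0; split=> //; first by rewrite addrA.
  by apply: spnS.
exists p, (k *: mon s (e0 :: t) w + q), (e0 :: es0); split=> //.
  by rewrite addrCA.
move=> es ues sub.
rewrite (eq_bigr (fun e => (k *: mon s (e0 :: t) w) ** gE e ** gG e + q ** gE e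
  ** gG e)); last first.
  by move=> e _; rewrite !amulDl.
rewrite big_split /= -IH //; last first.
  by move=> e he; apply: sub; rewrite in_cons he orbT.
have me e : mon s (e0 :: t) w ** gE e ** gG e =
    if e0 == e then mon s (e0 :: t) w else 0.
  rewrite /mon -!amulA /= (amulA (gG e0)) GE; case: eqP => [<-|_]; last first.
    by rewrite amul0l !amul0.
  by rewrite VG eqxx.
congr (_ + _); rewrite (bigD1_seq e0) //=; last by apply: sub;
  rewrite in_cons eqxx.
rewrite -!scale_amull me eqxx big1 ?addr0 // => e ne.
by rewrite -!scale_amull me eq_sym (negbTE ne) scaler0.
Qed.

(** By induction $ae=0$ for every edge. If $v$ is regular, $a=av=\sum aee^*=0$. Otherwise split off
    the ghost-free part $p$ of $a$: on the path of length 0 at $v$ every $e^*$ vanishes, so $p$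
    vanishes there, which gives $pv=0$ and then $a=0$. *)
Lemma faithful_bounded k v a : spn (fun t => (size t <= k)%N) a ->
  a = a ** gV v -> kills a -> a = 0.
Proof.
elim: k v a => [|k IH] v a sa av ka.
  have [z hz] := bpath_exists v; rewrite av; apply: (pure_faithful _ hz).
    by apply: spn_sub sa => t; rewrite leqn0 => /nilP.
  exact: ka.
have ae e : a ** gE e = 0.
  apply: (IH (rng e)); [exact: spn_E|by rewrite -amulA EV eqxx|exact: kills_E].
have [reg|sing] := pselect (regular v).
  have [r er] := CK2 reg; rewrite av er amul_sumr big1 // => e _.
  by rewrite amulA ae amul0l.
have hp : sink (frng (fnil v)) \/ inf_emitter (frng (fnil v)).
  by apply: contrapT => /not_orP h; apply: sing.
pose x0 := BFin hp.
have [p [q [es [ea sp eq]]]] := ghost_decomp a.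
(* From $ae=0$ one gets $qe=-pe$. *)
have {}ea : a = p - \sum_(e <- es) p ** gE e ** gG e.
  rewrite ea; congr (p + _); rewrite eq -sumrN; apply: eq_bigr => e _.
  have -> : q = a - p by rewrite ea addrC addKr.
  by rewrite amulBl ae sub0r -scaleN1r -scale_amull scaleN1r.
have p0 : p ** gV v = 0.
  apply: (@pure_faithful p v x0) => //.
  have := ka x0 0; rewrite ea rhoB rho_suml big1 ?subr0 // => e _.
  by rewrite rhoM opG_dlt /= rho0.
rewrite av ea amulBl p0 sub0r amul_suml big1 ?oppr0 // => e _.
rewrite -amulA GV; case: eqP => [sv|_]; last by rewrite amul0.
have -> : gE e = gV v ** gE e by rewrite VE sv eqxx.
by rewrite (amulA p) p0 !amul0l.
Qed.

(** The test uses point masses only; they do not span all functions when the space is infinite.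
    Local units reduce to one vertex, and a finite combination of monomials has bounded ghost
    length. *)
Theorem rho_faithful a : kills a -> a = 0.
Proof.
move=> ka; have [vs ea] := local_unit a; rewrite ea big1 // => v _.
have [k sk] : exists k, spn (fun t => (size t <= k)%N) a.
  elim: (spn_full a) => [|c s t w b _ _ [k IH]]; first by exists 0%N;
    exact: spn0.
  exists (maxn k (size t)); apply: spnS; first exact: leq_maxr.
  by apply: spn_sub IH => t' h; rewrite leq_max h.
apply: (@faithful_bounded k v);
  [exact: spn_V|by rewrite -amulA VV eqxx|exact: kills_V].
Qed.

(** * Degree translations, diagonal coefficients and Laurent polynomials *)

Definition shiftf (k : int) f : F := fun p => f (p.1, p.2 - k).

Lemma rho_shift (k : int) a f : rho a (shiftf k f) = shiftf k (rho a f).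
Proof.
have [u ->] := pclass_surj a; rewrite !rho_pclass.
elim: u f => [[v|e|e]||u1 IH1 u2 IH2|c u1 IH1|u1 IH1 u2 IH2] f //=.
- apply/funext => -[x n]; rewrite /opE /shiftf /=; case: ifP => // _.
  by congr (f (_, _)); lia.
- apply/funext => -[x n]; rewrite /opG /shiftf /=; case: ifP => // _.
  by congr (f (_, _)); lia.
- by rewrite IH1 IH2.
- by rewrite IH1.
- by rewrite IH2 IH1.
Qed.

Lemma dlt_shift x (k : int) n : dlt x (n + k) = shiftf k (dlt x n).
Proof.
apply/funext => -[y m]; rewrite /shiftf !dltE;
  congr ((nat_of_bool (_ && _))%:R) => /=; lia.
Qed.

Lemma rho_dlt_shift a x n y m : rho a (dlt x n) (y, m) = rho a (dlt x 0) (y, m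
  - n).
Proof. by rewrite -[n in LHS]add0r dlt_shift rho_shift. Qed.

Lemma rho_support a x : exists N : nat, forall y m, (N < `|m|)%N ->
  rho a (dlt x 0) (y, m) = 0.
Proof.
elim: (spn_full a) => [|k s t w b _ _ [N IH]]; first by exists 0%N => y m _;
  rewrite rho0l.
exists (maxn N (size t + size s)) => y m; rewrite gtn_max => /andP[h1 h2].
rewrite rhoD rhoZ fctE IH // addr0.
have [->|[z [_ _ _ _ ->]]] := mon_dltP s t w x 0; first by rewrite scaler0.
rewrite [LHS]/(k * _) dltE (_ : (m == _) = false) ?andbF; first exact: mulr0.
by apply/eqP => hm; move: h2; rewrite hm; lia.
Qed.

(** Degree 0 forces $|s|=|t|$, so $st^*$ has a nonzero diagonal coefficient only for $s=t$; there
    the coefficient is the indicator of a clopen cylinder. *)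
Lemma diag_locally_constant a x :
  nbhs x [set y | rho a (dlt y 0) (y, 0) = rho a (dlt x 0) (x, 0)].
Proof.
elim: (spn_full a) => [|k s t w b _ _ IH].
  by apply: filterE => y /=; rewrite !rho0l.
have [C clC hC] : exists2 C : set (bpath E), clopen C & forall y,
    rho (mon s t w) (dlt y 0) (y, 0) = (`[< C y >])%:R.
  have [[c st]|h] := pselect (comp s w /\ s = t).
    subst t; have [p [<- _ <-]] := fpath_of c; exists (cyl p);
      first exact: clopen_cyl.
    move=> y; have [yp|nyp] := asboolP (cyl p y).
      have /cylP[z hz ->] := yp.
      rewrite mon_dlt //; try exact: comp_fpath.
      by rewrite dltE eqxx /= (_ : 0 == _) //; apply/eqP; lia.
    rewrite mon_dlt0 // => z _ _ hz ey; apply: nyp; rewrite ey; exact: cyl_ucat.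
  exists set0; first by split; [exact: open0|exact: closed0].
  move=> y; rewrite asboolF //.
  have [->//|[z [cs ct hz ey ->]]] := mon_dltP s t w y 0.
  rewrite dltE {1}ey; case: eqP => //= est; case: eqP => //= e0; case: h;
    split=> //.
  by apply/esym; apply: ucat_eq_list est; rewrite ?hz //; lia.
have nC : nbhs x [set y | C y <-> C x].
  have [oC cC] := clC; have [Cx|nCx] := pselect (C x).
    by apply: filterS (open_nbhs_nbhs (conj oC Cx)) => y Cy.
  by apply: filterS (open_nbhs_nbhs (conj (closed_openC cC) nCx)) => y nCy;
    split.
apply: filterS (filterI IH nC) => y [/= e1 e2].
by rewrite !rhoD !rhoZ !fctE e1 !hC (asbool_equiv_eq e2).
Qed.

(** The coefficients of the Laurent polynomial [q / 'X^k], placed on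
    [{x} * int]. *)
Definition laurent x (k : nat) (q : {poly K}) : F := fun p =>
  if (p.1 == x) && (0 <= p.2 + k%:Z) then q`_(absz (p.2 + k%:Z)) else 0.

Lemma laurent_linear x k c (q q' : {poly K}) :
  laurent x k (c *: q + q') = c *: laurent x k q + laurent x k q'.
Proof.
apply/funext => -[y m]; rewrite /laurent !fctE /=; case: ifP => _.
  by rewrite coefD coefZ.
by rewrite scaler0 addr0.
Qed.

Lemma laurent_inj x k : injective (laurent x k).
Proof.
move=> q q' h; apply/polyP => i.
have := congr1 (fun f : F => f (x, i%:Z - k%:Z)) h.
by rewrite /laurent /= eqxx subrK /=.
Qed.

Lemma laurentXn x k i : laurent x k 'X^i = dlt x (i%:Z - k%:Z).
Proof.
apply/funext => -[y m]; rewrite /laurent dltE /=; case: (y == x) => //=.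
case: ifP => h; first by rewrite coefXn; congr ((nat_of_bool _)%:R);
  apply/eqP/eqP; lia.
by case: eqP => // em; move: h; rewrite em subrK.
Qed.

(** Commuting with translations, [a] multiplies the functions on $\{x\}\times\mathbb Z$ of the form
    [laurent] by a fixed Laurent polynomial. As these form a domain, an idempotent one is 0 or 1.
    The degrees lie in $[-N,N]$, so a factor $X^N$ keeps the computation in $K[X]$. *)
Lemma supported_idempotent a x :
  (forall y m, y <> x -> rho a (dlt x 0) (y, m) = 0) ->
  a ** a = a -> rho a (dlt x 0) = 0 \/ rho a (dlt x 0) = dlt x 0.
Proof.
move=> supp idem; have [N hN] := rho_support a x.
pose p : {poly K} := \poly_(i < N.*2.+1) rho a (dlt x 0) (x, i%:Z - N%:Z).
have act i : rho a (dlt x (i%:Z - N%:Z)) = laurent x (N + N) (p * 'X^i).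
  apply/funext => -[y m]; rewrite rho_dlt_shift /laurent /=.
  case: (y =P x) => [->|/supp -> //] /=.
  rewrite coefMXn coef_poly; case: ifP => h; last first.
    by apply: hN; lia.
  case: ifP => h1; first by apply: hN; lia.
  case: ifP => h2; last by apply: hN; lia.
  by congr (rho _ _ (_, _)); lia.
have actL q : rho a (laurent x N q) = laurent x (N + N) (p * q).
  have lin0 k : laurent x k 0 = 0.
    by apply/funext => -[y m]; rewrite /laurent coef0 if_same.
  rewrite -[q]coefK poly_def mulr_sumr.
  elim/big_rec2: _ => [|i u u' _ IH]; first by rewrite !lin0 rho0.
  rewrite laurent_linear rho_linear -scalerAr laurent_linear -IH.
  by rewrite laurentXn act.
have eN : laurent x N 'X^N = dlt x 0 by rewrite laurentXn subrr.
have h1 : rho a (dlt x 0) = laurent x N p.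
  apply/funext => -[y m]; rewrite /laurent /=.
  case: (y =P x) => [->|/supp -> //] /=; rewrite coef_poly.
  case: ifP => h; last by apply: hN; lia.
  case: ifP => h2; last by apply: hN; lia.
  by congr (rho _ _ (_, _)); lia.
(* Idempotence of $p/X^N$ with denominators cleared. *)
have h2 : p * p = p * 'X^N.
  apply: (@laurent_inj x (N + N)%N); rewrite -!actL eN -h1.
  by rewrite -rhoM idem.
have /eqP : p * (p - 'X^N) = 0 by rewrite mulrBr h2 subrr.
rewrite mulf_eq0 subr_eq0 => /orP[/eqP p0|/eqP pN]; rewrite h1 ?p0 ?pN.
  left; apply/funext => -[y m]; rewrite /laurent coef0 if_same //.
by right.
Qed.

(** * From a direct sum of ideals to a clopen invariant set *)

Section Decomposable.
Variables (I J : set L) (iI jJ : vert E -> L).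
Hypotheses (idI : ideal I) (idJ : ideal J) (IJ0 : I `&` J = [set 0]).
Hypothesis iI_in : forall v, I (iI v).
Hypothesis jJ_in : forall v, J (jJ v).
Hypothesis ij : forall v, gV v = iI v + jJ v.

Lemma meet0 a : I a -> J a -> a = 0.
Proof. by move=> ha hb; have : (I `&` J) a by []; rewrite IJ0. Qed.

Lemma split_uniq a a' b b' : I a -> I a' -> J b -> J b' -> a + b = a' + b' ->
  a = a' /\ b = b'.
Proof.
move=> Ia Ia' Jb Jb' h.
have e : a - a' = b' - b.
  by apply/eqP; rewrite subr_eq addrAC -subr_eq opprK h addrC.
have e0 : a - a' = 0.
  by apply: meet0; [exact: ideal_sub|rewrite e; exact: ideal_sub].
split; first by apply/eqP; rewrite -subr_eq0 e0.
by apply/esym/eqP; rewrite -subr_eq0 -e e0.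
Qed.

(** Compare the [I]-components of $av=wa$. Taking $a=\alpha\alpha^*$ localizes the support, and
    taking $a=e$ gives invariance. *)
Lemma component_comm v w a : gV w ** a = a -> a ** gV v = a -> a ** iI v = iI w
  ** a.
Proof.
move=> wa av.
suff [] : a ** iI v = iI w ** a /\ a ** jJ v = jJ w ** a by [].
apply: split_uniq.
- exact: ideal_mull.
- exact: ideal_mulr.
- exact: ideal_mull.
- exact: ideal_mulr.
- by rewrite -amulDr -amulDl -!ij wa av.
Qed.

Lemma component_right v : iI v ** gV v = iI v.
Proof.
suff [] : iI v ** gV v = iI v /\ jJ v ** gV v = jJ v by [].
apply: split_uniq => //; try exact: ideal_mulr.
by rewrite -amulDl -!ij VV eqxx.
Qed.

Lemma component_left v : gV v ** iI v = iI v.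
Proof.
suff [] : gV v ** iI v = iI v /\ gV v ** jJ v = jJ v by [].
apply: split_uniq => //; try exact: ideal_mull.
by rewrite -amulDr -!ij VV eqxx.
Qed.

Lemma cross0 a b : I a -> J b -> a ** b = 0.
Proof. by move=> Ia Jb; apply: meet0;
  [exact: ideal_mulr|exact: ideal_mull]. Qed.

Lemma component_idem v : iI v ** iI v = iI v.
Proof.
by rewrite -[RHS]component_right ij amulDr (cross0 (iI_in v) (jJ_in v)) addr0.
Qed.

(** [iI v] commutes with the projections [alpha alpha^*], and these separate
    boundary paths. *)
Lemma component_support v x n y m : bsrc x = v -> y <> x ->
  rho (iI v) (dlt x n) (y, m) = 0.
Proof.
move=> hx nyx; have [hy|hy] := eqVneq (bsrc y) v; last first.
  by rewrite -component_left rhoM rhoV /opV /= (negbTE hy).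
have [k nk] : exists k, bnth x k <> bnth y k.
  apply: contrapT => h; apply: nyx; apply: bpath_eq; first by rewrite hy hx.
  by move=> k; apply: contrapT => hk; apply: h; exists k; exact: nesym.
have comm z (j : nat) f : bsrc z = v ->
    let Q := mon (bedges z j) (bedges z j) (bsrc (iter j (@bshift E) z)) in
    rho (iI v) (rho Q f) = rho Q (rho (iI v) f).
  move=> hz Q; rewrite -!rhoM; congr (rho _ _).
  have hh : hd (bedges z j) (bsrc (iter j (@bshift E) z)) = v.
    by have [<- _] := bpre_split z j; rewrite (hd_fpath (bpre z j)).
  apply/esym; apply: component_comm; last by rewrite /Q mon_V hh eqxx.
  by rewrite /Q /mon amulA V_mE hh eqxx.
have sep z1 z2 j e : bnth z1 j = Some e -> bnth z2 j <> Some e ->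
    forall z, bsrc z = bsrc (iter j.+1 (@bshift E) z1) ->
    comp (bedges z1 j.+1) (bsrc z) -> z2 <> ucat (bedges z1 j.+1) z.
  move=> h1 h2 z hz c ez; apply: h2; rewrite ez -h1.
  have sz : (j < size (bedges z1 j.+1))%N.
    by rewrite (size_bedges_some h1).
  rewrite bnth_ucat // sz; have [e1 e2] := bpre_split z1 j.+1.
  by rewrite e2 bnth_ucat ?sz // -?e2 // ; exact: comp_bedges.
(* If [x] has an edge at position [k], the projection of its prefix fixes the point mass and
   vanishes at [y]. If [x] ends before, the projection of the prefix of [y] is used: it kills the
   point mass at [x] and is the identity at [y]. *)
case ex: (bnth x k) => [e|].
  have ne : bnth y k <> Some e by rewrite -ex; exact: nesym.
  set s := bedges x k.+1; set w := bsrc (iter k.+1 (@bshift E) x).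
  have cs : comp s w by exact: comp_bedges.
  have -> : dlt x n = rho (mon s s w) (dlt x n).
    have [_ e2] := bpre_split x k.+1; rewrite {2}e2 mon_dlt // -e2.
    by congr (dlt _ _); lia.
  rewrite comm // rhoM rho_mE0 // => z _ hz; apply: (sep _ _ _ _ ex ne z) => //.
  by rewrite hz.
case ey: (bnth y k) => [e|]; last by case: nk; rewrite ex ey.
have ne : bnth x k <> Some e by rewrite ex.
set s := bedges y k.+1; set w := bsrc (iter k.+1 (@bshift E) y).
have cs : comp s w by exact: comp_bedges.
have := comm y k.+1 (dlt x n) hy; rewrite /= -/s -/w mon_dlt0; last first.
  move=> z _ _ hz; apply: (sep _ _ _ _ ey ne z) => //; by rewrite hz.
have pt g : rho (mon s s w) g (y, m) = g (y, m).
  have [_ e2] := bpre_split y k.+1.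
  have -> : (y, m) = (ucat s (iter k.+1 (@bshift E) y), m) by rewrite -e2.
  by rewrite rhoM rho_mE1 // rho_mG1 // subrK.
by rewrite rho0 => /(congr1 (fun f : F => f (y, m))); rewrite pt => <-.
Qed.

Lemma component_dlt x : rho (iI (bsrc x)) (dlt x 0) = 0 \/
  rho (iI (bsrc x)) (dlt x 0) = dlt x 0.
Proof.
apply: supported_idempotent; last exact: component_idem.
by move=> y m ne; exact: component_support.
Qed.

Definition component_set : set (bpath E) :=
  [set x | rho (iI (bsrc x)) (dlt x 0) = dlt x 0].

(** Membership becomes the value of one diagonal coefficient, to which [diag_locally_constant]
    applies. *)
Lemma component_setP x : component_set x <-> rho (iI (bsrc x)) (dlt x 0) (x, 0)
  = 1.
Proof.
rewrite /component_set /=; split=> [->|h]; first by rewrite dltE !eqxx.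
have [h0|//] := component_dlt x; move: h; rewrite h0 => /eqP.
by rewrite eq_sym oner_eq0.
Qed.

Lemma component_set_near x : nbhs x [set y | component_set y <-> component_set
  x].
Proof.
have nV : nbhs x [set y | bsrc y = bsrc x].
  have [oc _] := clopen_cyl (fnil (bsrc x)).
  have xc : cyl (fnil (bsrc x)) x by exact/cyl_nil.
  by apply: filterS (open_nbhs_nbhs (conj oc xc)) => y /cyl_nil.
apply: filterS (filterI nV (diag_locally_constant (iI (bsrc x)) x)) => y [/= e1
  e2].
by rewrite !component_setP e1 e2.
Qed.

Lemma component_set_clopen : clopen component_set.
Proof.
split; last rewrite -[component_set]setCK closedC; apply: open_nbhsW => x Ux;
  apply: filterS (component_set_near x) => y /= h; [exact/h|by move=> /h].
Qed.

Lemma component_set_invariant : gpd_invariant component_set.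
Proof.
apply: invariant_edge => e x hx.
have := @component_comm (rng e) (src e) (gE e).
rewrite VE EV !eqxx => /(_ erefl erefl) /(congr1 (fun a => rho a (dlt x 0))).
rewrite !rhoM opE_dlt hx eqxx -(bsrc_bcons hx) -hx => h.
(* Acting by [e] lands in degree 1, while [component_set] is defined in degree 0. *)
have sh : rho (iI (bsrc (bcons e x))) (dlt (bcons e x) (0 + 1)) =
    shiftf 1 (rho (iI (bsrc (bcons e x))) (dlt (bcons e x) 0)).
  by rewrite dlt_shift rho_shift.
split=> [U1|U2].
  apply/component_setP; have [h0|->] := component_dlt x;
    last by rewrite dltE !eqxx.
  move: h; rewrite hx h0 rho0 sh U1 => /(congr1 (fun f : F => f (bcons e x,
    1))).
  by rewrite /shiftf /= dltE subrr !eqxx => /eqP; rewrite eq_sym oner_eq0.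
apply/component_setP.
have := h; rewrite hx U2 opE_dlt hx eqxx sh => /(congr1 (fun f : F => f (bcons
  e x, 1))).
by rewrite /shiftf /= subrr => <-; rewrite dltE !eqxx.
Qed.

Lemma component_set_nonempty : I <> [set 0] -> component_set !=set0.
Proof.
move=> In0; have [a Ia an0] : exists2 a, I a & a <> 0.
  apply: contrapT => h; apply: In0; apply/seteqP; split=> a; last first.
    by move=> ->; case: idI.
  by move=> Ia; apply: contrapT => na; apply: h; exists a.
have [v avn0] : exists v, a ** gV v <> 0.
  apply: contrapT => h; apply: an0; have [vs ->] := local_unit a.
  by rewrite big1 // => v _; apply: contrapT => hv; apply: h; exists v.
(* As $a\in I$ annihilates $J$ from the left, $av$ is the product of $a$ with the [I]-component of
   $v$. *)
have ivn0 : iI v <> 0.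
  by move=> iv0; apply: avn0; rewrite ij iv0 add0r cross0.
have [x [n hxn]] : exists x n, rho (iI v) (dlt x n) <> 0.
  apply: contrapT => h; apply: ivn0; apply: rho_faithful => x n.
  by apply: contrapT => hn; apply: h; exists x, n.
have hv : bsrc x = v.
  apply: contrapT => nv; apply: hxn.
  by rewrite -component_right rhoM opV_dlt (introF eqP nv) rho0.
exists x; have [h0|//] := component_dlt x; case: hxn.
by rewrite -[n]add0r dlt_shift rho_shift -hv h0.
Qed.

End Decomposable.

Theorem decomposable_clopen  :
  decomposable L -> exists U : set (bpath E),
    [/\ U !=set0, U `<` setT, clopen U & gpd_invariant U].
Proof.
move=> [I [J [idI idJ In0 Jn0 [LIJ IJ0]]]].
have /choice[c hc] : forall v, exists p : L * L,
    [/\ I p.1, J p.2 & gV v = p.1 + p.2].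
  move=> v; have : [set: L] (gV v) by [].
  by rewrite LIJ => -[a Ia [b Jb <-]]; exists (a, b).
pose iI v := (c v).1; pose jJ v := (c v).2.
have iIin v : I (iI v) by case: (hc v).
have jJin v : J (jJ v) by case: (hc v).
have ij v : gV v = iI v + jJ v by case: (hc v).
have ji v : gV v = jJ v + iI v by rewrite addrC.
have JI0 : J `&` I = [set 0] by rewrite setIC.
exists (component_set iI); split.
- exact: (component_set_nonempty idI idJ IJ0 iIin jJin ij In0).
(* Exchange the two ideals: where both components acted by 1, the vertex would act by 2 and by 1. *)
- have [x hx] := component_set_nonempty idJ idI JI0 jJin iIin ji Jn0.
  apply/properTP; exists x => hx'.
  have := opV_dlt (bsrc x) x 0; rewrite eqxx ij rhoD hx hx'.
  move=> /(congr1 (fun f : bpath E * int -> K^o => f (x, 0))).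
  rewrite fctE dltE !eqxx /= => /eqP; rewrite -subr_eq0 addrK.
  by rewrite oner_eq0.
- exact: (component_set_clopen idI idJ IJ0 iIin jJin ij).
- exact: (component_set_invariant idI idJ IJ0 iIin jJin ij).
Qed.

(** * From a clopen invariant set to a direct sum of ideals *)

Definition represents b W := forall x n,
  rho b (dlt x n) = if `[< W x >] then dlt x n else 0.

Definition representable W := exists b, represents b W.

Lemma representable_cyl (p : fpath E) : representable (cyl p).
Proof.
exists (mon (fedges p) (fedges p) (frng p)) => x n; have cp := comp_fpath p.
case: asboolP => [/cylP[z hz ->]|h].
  by rewrite mon_dlt //; congr (dlt _ _); lia.
by rewrite mon_dlt0 // => z _ _ hz ex; apply: h; rewrite ex; exact: cyl_ucat.
Qed.

Lemma representable0 : representable set0.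
Proof. by exists 0 => x n; rewrite rho0l asboolF. Qed.

Lemma representableU W W' : representable W -> representable W' ->
  representable (W `|` W').
Proof.
move=> [b hb] [b' hb']; exists (b + b' - b ** b') => x n.
rewrite rhoB rhoD rhoM hb hb' asbool_or; case: `[< W' x >]; rewrite ?hb ?rho0;
  by case: `[< W x >]; rewrite /= ?addrK ?addr0 ?add0r ?subr0 ?subrr.
Qed.

Lemma representableD W W' : representable W -> representable W' ->
  representable (W `\` W').
Proof.
move=> [b hb] [b' hb']; exists (b - b ** b') => x n.
rewrite rhoB rhoM hb hb' asbool_and asbool_neg.
case: `[< W' x >]; rewrite ?hb ?rho0;
  by case: `[< W x >]; rewrite /= ?subr0 ?subrr.
Qed.

Lemma representable_bigcup (I : choiceType) (D : set I) (f : I -> set (bpath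
  E)) :
  finite_set D -> (forall i, D i -> representable (f i)) ->
  representable (\bigcup_(i in D) f i).
Proof.
move=> /finite_seqP[r ->]; elim: r => [|i r IH] h.
  by rewrite set_nil bigcup_set0; exact: representable0.
have -> : [set` i :: r] = i |` [set` r].
  apply/seteqP; split=> j /=; rewrite in_cons; first by move=> /orP[/eqP|];
    [left|right].
  by move=> [->|->]; rewrite ?eqxx ?orbT.
rewrite bigcup_setU1; apply: representableU.
  by apply: h; rewrite /= in_cons eqxx.
by apply: IH => j jr; apply: h; rewrite /= in_cons jr orbT.
Qed.

Lemma representable_cylD (p : fpath E) (A : set (edge E)) : finite_set A ->
  representable (cylD p A).
Proof.
move=> fA; have -> : cylD p A = cyl p `\` \bigcup_(e in A) cylE p e.
  apply/seteqP; split=> x [px h]; split=> //.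
    by move=> [e Ae [_ he]]; exact: h he.
  by move=> e Ae he; apply: h; exists e.
apply: representableD; first exact: representable_cyl.
apply: representable_bigcup => // e _.
have [he|he] := pselect (src e = frng p).
  by have [b [_ _ _ <-]] := fsnocP he; exact: representable_cyl.
suff -> : cylE p e = set0 by exact: representable0.
by apply/seteqP; split=> // x [px /(cyl_next px)].
Qed.

(** Compactness in filter form. If [W] is not representable, the complements in [W] of its
    representable subsets generate a proper filter, because these subsets are closed under finite
    unions. A cluster point has a representable neighbourhood inside [W], whose complement in [W]
    belongs to the filter: a contradiction. *)
Lemma representable_clopen v U : clopen U -> representable (cyl (fnil v) `&` U).
Proof.
move=> [oU cU]; set W := _ `&` U.
have cW : compact W by apply: compact_closedI => //; exact: compact_cyl.
have oW : open W by apply: openI => //; exact: open_cyl.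
apply: contrapT => nW.
pose D := [set B | B `<=` W /\ representable B].
pose G := filter_from D (fun B => W `\` B).
have PG : ProperFilter G.
  apply: filter_from_proper.
    apply: filter_from_filter; first by exists set0; split=> //;
      exact: representable0.
    move=> B B' [sB rB] [sB' rB']; exists (B `|` B'); last by rewrite setDUr.
    by split; [rewrite subUset|exact: representableU].
  move=> B [sB rB]; apply: contrapT => /nonemptyPn WB; apply: nW.
  suff -> : W = B by [].
  by apply/seteqP; split=> // x Wx; apply: contrapT => nBx;
    have : (W `\` B) x by []; rewrite WB.
have GW : G W.
  by exists set0; [split=> //; exact: representable0|rewrite setD0].
have [x [Wx clx]] := cW G PG GW.
have /nbhs_cylD[a [A [fA ax sA]]] : nbhs x W by exact: open_nbhs_nbhs.
have [||y [[_ nAy] Ay]] := clx (W `\` cylD a A) (cylD a A).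
- by exists (cylD a A) => //; split=> //; exact: representable_cylD.
- exact: nbhs_of_cylD ax _.
- exact: nAy.
Qed.

Definition vanishing U : set L :=
  [set a | forall x n, ~ U x -> rho a (dlt x n) = 0].

(** Invariance matters for multiplication on the right: a monomial sends a point mass off [U] to 0
    or to a point mass in the same orbit, hence off [U]. *)
Lemma vanishing_ideal U : gpd_invariant U -> ideal (vanishing U).
Proof.
move=> inv; split.
- by move=> x n _; rewrite rho0l.
- by move=> a b ha hb x n nU; rewrite rhoD ha // hb // addr0.
- by move=> k a ha x n nU; rewrite rhoZ ha // scaler0.
move=> b a ha; split=> x n nU; rewrite rhoM; first by rewrite ha // rho0.
elim: (spn_full b) => [|k s t w c _ _ IH]; first by rewrite rho0l rho0.
rewrite rhoD rhoZ rho_linear IH addr0.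
have [->|[z [cs ct hz ex ->]]] := mon_dltP s t w x n;
  first by rewrite rho0 scaler0.
rewrite ha ?scaler0 // => Us; apply: nU; rewrite ex.
by apply/invariant_ucat; rewrite ?hz //; apply/(invariant_ucat inv (s := s));
  rewrite ?hz.
Qed.

Theorem clopen_decomposable U : U !=set0 -> U `<` setT -> clopen U ->
  gpd_invariant U -> decomposable L.
Proof.
move=> [x0 Ux0] /properTP[x1 nUx1] clU inv; have invC := invariantC inv.
have /choice[c hc] : forall v, exists b, represents b (cyl (fnil v) `&` U).
  by move=> v; exact: representable_clopen.
have cI v : vanishing U (c v).
  by move=> x n nU; rewrite hc asboolF // => -[].
have cJ v : vanishing (~` U) (gV v - c v).
  move=> x n /contrapT Ux; rewrite rhoB opV_dlt hc.
  case: eqP => [ev|nv]; case: asboolP => h; rewrite ?subrr ?subr0 //.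
    by case: h; split=> //; exact/cyl_nil.
  by case: h => /cyl_nil /nv.
exists (vanishing U), (vanishing (~` U)); split.
- exact: vanishing_ideal.
- exact: vanishing_ideal.
- move=> e; have := cI (bsrc x0); rewrite e => /= c0.
  have := hc (bsrc x0) x0 0; rewrite c0 rho0l asboolT; last first.
    by split=> //; exact/cyl_nil.
  move=> /(congr1 (fun f : F => f (x0, 0))); rewrite dltE !eqxx => /eqP.
  by rewrite eq_sym oner_eq0.
- move=> e; have := cJ (bsrc x1); rewrite e => /= c0.
  have := rhoB (gV (bsrc x1)) (c (bsrc x1)) (dlt x1 0).
  rewrite c0 rho0l opV_dlt eqxx hc asboolF ?subr0; last by case.
  move=> /(congr1 (fun f : F => f (x1, 0))); rewrite dltE !eqxx => /eqP.
  by rewrite eq_sym oner_eq0.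
split; apply/seteqP; split=> // a.
(* Split each $av$ as $ac_v+a(v-c_v)$, where $c_v$ acts as the indicator of $Z(v)\cap U$. *)
- move=> _; have [vs ea] := local_unit a.
  exists (\sum_(v <- vs) a ** c v).
    apply: ideal_sum; first exact: vanishing_ideal.
    by move=> v; exact: ideal_mull (vanishing_ideal inv) (cI v).
  exists (\sum_(v <- vs) a ** (gV v - c v)).
    apply: ideal_sum; first exact: vanishing_ideal.
    by move=> v; exact: ideal_mull (vanishing_ideal invC) (cJ v).
  rewrite -big_split /= [RHS]ea; apply: eq_bigr => v _.
  by rewrite -amulDr addrC subrK.
- move=> [h1 h2]; apply: rho_faithful => x n.
  have [Ux|nUx] := pselect (U x); last exact: h1.
  by apply: h2.
- by move=> ->; split=> x n _; rewrite rho0l.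
Qed.

End Representation.

(** * The cycle of implications *)

Theorem theorem5p2 (K : fieldType) (E : graph) :
  [<-> decomposable (leavitt K E);
       exists U V : set (bpath E),
         [/\ U !=set0, clopen U & gpd_invariant U] /\
         [/\ V !=set0, clopen V & gpd_invariant V] /\
         direct_sum (steinberg K E) (steinberg_ideal K U) (steinberg_ideal K V);
       exists H : set (vert E),
         [/\ H !=set0, H `<` setT, hereditary H & saturated H] /\
         (forall x : ipath E, ivertices x `<=` ~` H ->
            exists N : nat, paths (rng (x N)) H = set0) /\
         (forall v : vert E,
            infinite_set [set e : edge E | src e = v /\
                                           paths (rng e) H !=set0] ->
            (H `|` breaking H) v);
       exists U : set (bpath E),
         [/\ U !=set0, U `<` setT, clopen U & gpd_invariant U]].
Proof.
have steinberg_clopen U V : [/\ U !=set0, clopen U & gpd_invariant U] /\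
      [/\ V !=set0, clopen V & gpd_invariant V] /\
      direct_sum (steinberg K E) (steinberg_ideal K U) (steinberg_ideal K V) ->
    [/\ U !=set0, U `<` setT, clopen U & gpd_invariant U].
  move=> [[U0 clU iU] [[[y Vy] clV _] [_ UV0]]]; split=> //.
  (* Disjointness turns nonemptiness of [V] into properness of [U]. *)
  have UV := steinberg_disjoint clU.1 clV.1 UV0.
  by apply/properTP; exists y => Uy; have : (U `&` V) y by []; rewrite UV.
tfae.
- move=> /decomposable_clopen[U [U0 /properTP[x nUx] clU iU]]; exists U, (~` U).
  split=> //; split; last exact: steinberg_direct_sum.
  split; [by exists x| |exact: invariantC].
  by split; [exact: closed_openC clU.2|exact: open_closedC clU.1].
- move=> [U [V /steinberg_clopen[U0 UT clU iU]]].
  by exists (inside U); exact: clopen_splitting.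
- move=> [H hH]; exists (entering H); split.
  + exact: (entering_nonempty (H := H)).
  + exact: (entering_proper (H := H)).
  + by split; [exact: (entering_open (H := H))|exact: (entering_closed (H :=
    H))].
  + exact: (entering_invariant (H := H)).
- by move=> [U [U0 UT clU iU]]; exact: clopen_decomposable U0 UT clU iU.
Qed.
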